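(* Let $p$ be a prime, let $\epsilon>0$, and let $u\ge 0$ be an integer. For each $n$ let $X_n\in M_{n\times(n+u)}(\mathbb{Z}_p)$ be a random matrix with independent entries such that for every entry $(X_n)_{i,j}$ and every $r\in\mathbb{Z}/p\mathbb{Z}$ we have $\mathbb{P}((X_n)_{i,j}\equiv r\pmod p)\le 1-\epsilon$. Then for every finite abelian $p$-group $B$, $$\lim_{n\to\infty}\mathbb{P}(\operatorname{cok}(X_n)\simeq B)=\frac{\prod_{k=1}^\infty(1-p^{-k-u})}{|B|^u|\operatorname{Aut}(B)|}.$$
   Context: $\mathbb{Z}_p$ denotes the ring of $p$-adic integers, and $\mathbb{P}$ denotes probability. For a matrix $X\in M_{n\times(n+u)}(\mathbb{Z}_p)$, viewed as a map $\mathbb{Z}_p^{n+u}\to\mathbb{Z}_p^n$, $\operatorname{cok}(X)=\mathbb{Z}_p^n/X\mathbb{Z}_p^{n+u}$ is its cokernel. The entries are not required to be identically distributed, and their distributions may vary with $n$; $\epsilon$ and $u$ do not depend on $n$. *)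

(* Defs.v *)
From HB Require Import structures.
From mathcomp Require Import all_boot all_order all_algebra all_fingroup.
From mathcomp Require Import all_solvable.
From mathcomp Require Import all_classical all_reals all_analysis.

Set Implicit Arguments.
Unset Strict Implicit.
Unset Printing Implicit Defensive.

Import Order.TTheory GRing.Theory Num.Theory.

Local Open Scope classical_set_scope.
Local Open Scope ring_scope.

(* The p-adic integers, as the projective limit of the rings Z/p^(k+1), so    *)
(* that residue x k is the reduction of x modulo p^(k+1).                     *)
(* The exponents start at 1 because 'Z_1 is Z/2 in MathComp. For the same     *)
(* reason the type is meaningful only when 1 < p; it is still a ring          *)
(* otherwise, which spares a primality proof as a parameter of the type.      *)
Section PadicInt.
Variable p : nat.

Definition Zp_red k (a : 'Z_(p ^ k.+2)) : 'Z_(p ^ k.+1) := inZp a.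

Record padic_int := PadicInt {
  residue :> forall k, 'Z_(p ^ k.+1);
  residueP : forall k, Zp_red (residue k.+1) = residue k }.

Lemma padic_intP (x y : padic_int) : (forall k, x k = y k) -> x = y.
Proof.
case: x y => [x xP] [y yP] /= exy.
have {exy}exy : x = y by exact: functional_extensionality_dep.
by case: y / exy yP => yP; rewrite (Prop_irrelevance xP yP).
Qed.

Lemma Zp_trunc_dvd k :
  ((Zp_trunc (p ^ k.+1)).+2 %| (Zp_trunc (p ^ k.+2)).+2)%N.
Proof.
case: p => [|[|q]]; rewrite ?exp1n ?exp0n //.
by rewrite !Zp_cast ?(ltn_exp2l 0) // dvdn_exp2l.
Qed.

Lemma Zp_red0 k : @Zp_red k 0 = 0.
Proof. by apply: val_inj; rewrite /= mod0n. Qed.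

Lemma Zp_red1 k : @Zp_red k 1 = 1.
Proof. by apply: val_inj. Qed.

Lemma Zp_redD k : {morph @Zp_red k : a b / a + b}.
Proof.
move=> a b; apply: val_inj => /=.
by rewrite (modn_dvdm _ (Zp_trunc_dvd k)) modnDml modnDmr.
Qed.

Lemma Zp_redM k : {morph @Zp_red k : a b / a * b}.
Proof.
move=> a b; apply: val_inj => /=.
by rewrite (modn_dvdm _ (Zp_trunc_dvd k)) modnMml modnMmr.
Qed.

Lemma Zp_redN k : {morph @Zp_red k : a / - a}.
Proof.
by move=> a; apply: (addrI (Zp_red a)); rewrite -Zp_redD !subrr Zp_red0.
Qed.

Definition padic_zero := PadicInt Zp_red0.
Definition padic_one := PadicInt Zp_red1.

Fact padic_opp_subproof (x : padic_int) k : Zp_red (- x k.+1) = - x k.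
Proof. by rewrite Zp_redN residueP. Qed.
Definition padic_opp x := PadicInt (padic_opp_subproof x).

Fact padic_add_subproof (x y : padic_int) k :
  Zp_red (x k.+1 + y k.+1) = x k + y k.
Proof. by rewrite Zp_redD !residueP. Qed.
Definition padic_add x y := PadicInt (padic_add_subproof x y).

Fact padic_mul_subproof (x y : padic_int) k :
  Zp_red (x k.+1 * y k.+1) = x k * y k.
Proof. by rewrite Zp_redM !residueP. Qed.
Definition padic_mul x y := PadicInt (padic_mul_subproof x y).

HB.instance Definition _ := gen_eqMixin padic_int.
HB.instance Definition _ := gen_choiceMixin padic_int.

Fact padic_addA : associative padic_add.
Proof. by move=> x y z; apply: padic_intP => k /=; rewrite addrA. Qed.
Fact padic_addC : commutative padic_add.
Proof. by move=> x y; apply: padic_intP => k /=; rewrite addrC. Qed.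
Fact padic_add0 : left_id padic_zero padic_add.
Proof. by move=> x; apply: padic_intP => k /=; rewrite add0r. Qed.
Fact padic_addN : left_inverse padic_zero padic_opp padic_add.
Proof. by move=> x; apply: padic_intP => k /=; rewrite addNr. Qed.

HB.instance Definition _ :=
  GRing.isZmodule.Build padic_int padic_addA padic_addC padic_add0 padic_addN.

Fact padic_mulA : associative padic_mul.
Proof. by move=> x y z; apply: padic_intP => k /=; rewrite mulrA. Qed.
Fact padic_mulC : commutative padic_mul.
Proof. by move=> x y; apply: padic_intP => k /=; rewrite mulrC. Qed.
Fact padic_mul1 : left_id padic_one padic_mul.
Proof. by move=> x; apply: padic_intP => k /=; rewrite mul1r. Qed.
Fact padic_mulDl : left_distributive padic_mul +%R.
Proof. by move=> x y z; apply: padic_intP => k /=; rewrite mulrDl. Qed.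
Fact padic_one_neq0 : padic_one != 0.
Proof. by apply/eqP => /(congr1 (fun x : padic_int => x 0%N)). Qed.

HB.instance Definition _ := GRing.Zmodule_isComNzRing.Build padic_int
  padic_mulA padic_mulC padic_mul1 padic_mulDl padic_one_neq0.

(* The p-adic topology: the balls around x are {y | y = x mod p^(k+1)}.       *)
Definition padic_open : set_system padic_int :=
  [set U | forall x : padic_int, U x ->
    exists k, forall y : padic_int, y k = x k -> U y].

Lemma residue_le (x y : padic_int) j k : (j <= k)%N -> x k = y k -> x j = y j.
Proof.
move=> /subnK <-; elim: (k - j)%N => [//|i IHi] exy.
by apply: IHi; rewrite -(residueP x) -(residueP y) exy.
Qed.

Fact padic_openT : padic_open setT.
Proof. by move=> x _; exists 0%N. Qed.

Fact padic_openI : setI_closed padic_open.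
Proof.
move=> U V oU oV x [/oU[j Uj] /oV[k Vk]]; exists (maxn j k) => y eyx.
by split; [apply: Uj | apply: Vk];
  apply: residue_le eyx; rewrite ?leq_maxl ?leq_maxr.
Qed.

Fact padic_open_bigU (I : Type) (f : I -> set padic_int) :
  (forall i, padic_open (f i)) -> padic_open (\bigcup_i f i).
Proof.
by move=> of_ x [i _ /of_[k fk]]; exists k => y /fk fy; exists i.
Qed.

HB.instance Definition _ := isPointed.Build padic_int 0.
HB.instance Definition _ := isOpenTopological.Build padic_int
  padic_openT padic_openI padic_open_bigU.

HB.instance Definition _ := @isMeasurable.Build
  (sigma_display (@open padic_int)) padic_int <<s @open padic_int >>
  (@sigma_algebra0 _ setT _) (@sigma_algebraC _ _)
  (@sigma_algebra_bigcup _ setT _).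

End PadicInt.

Section Cokernel.
Variables (A : pzRingType) (n m : nat) (M : 'M[A]_(n, m)).

Definition mx_image : {pred 'cV[A]_n} :=
  fun y => `[< exists v : 'cV[A]_m, y = M *m v >].

Fact mx_image_zmod_closed : zmod_closed mx_image.
Proof.
split=> [|_ _ /asboolP[v ->] /asboolP[w ->]]; apply/asboolP.
  by exists 0; rewrite mulmx0.
by exists (v - w); rewrite mulmxBr.
Qed.

HB.instance Definition _ :=
  GRing.isZmodClosed.Build 'cV[A]_n mx_image mx_image_zmod_closed.

Definition cok : zmodType := Quotient.quot mx_image.

End Cokernel.

Definition additively_isomorphic (V W : zmodType) : Prop :=
  exists f : {additive V -> W}, bijective f.

Definition mutually_independent d d' (Omega : measurableType d)
    (T : measurableType d') (R : realType) (P : probability Omega R)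
    (I : finType) (Y : I -> Omega -> T) : Prop :=
  forall (J : {set I}) (E : I -> set T), (forall i, measurable (E i)) ->
    P [set w | forall i, i \in J -> E i (Y i w)] =
    (\prod_(i in J) P [set w | E i (Y i w)])%E.

(* Main.v *)
(* The surjections from [Z_p^n] onto [B] correspond to the tuples [b] that     *)
(* generate [B], and [cok X] is isomorphic to [B] iff [#|Aut B|] of them have  *)
(* kernel the image of [X] (otherwise none has). If the columns of [X] lie in  *)
(* the kernel [L] of [b], they span [L] iff no nonzero linear form [L -> F_p]  *)
(* kills them. This last event is sandwiched between truncations of a          *)
(* q-analogue of inclusion-exclusion, which only involve the expected numbers  *)
(* of pairs [(b, W)], with [W] a linearly independent family of [k] forms on   *)
(* [L], such that [b] and [W] both kill [X]. Such a pair is a tuple [c] in the *)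
(* group [B x (Z/p^(N+1))^k] that spans a subgroup of order [#|B| p^k].        *)
(*   The key estimate is that, for a fixed finite abelian p-group [G], the sum *)
(* over [c] in [G^n] of [`|P (c X = 0) - #|<c>| ^- (n + u)|] tends to 0. If    *)
(* [<c>] survives the deletion of any few entries of [c], then the entries can *)
(* be grouped into linearly many blocks, each of which reaches all of [<c>]    *)
(* with probability bounded below, so that [c X_j] is exponentially close to   *)
(* uniform. The other tuples are too few to matter.                            *)
(*   For uniform entries the same sums give the truncations of Euler's series  *)
(* for [\prod_(k >= 1) (1 - p^(-k-u))], hence the limit.                       *)

Require Import Defs.
From HB Require Import structures.
From mathcomp Require Import all_boot all_order all_algebra all_fingroup.
From mathcomp Require Import all_solvable mxabelem.
From mathcomp Require Import all_classical all_reals all_analysis.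
From mathcomp Require Import ring lra.

Set Implicit Arguments.
Unset Strict Implicit.
Unset Printing Implicit Defensive.

Import Order.TTheory GRing.Theory Num.Theory.
Import numFieldNormedType.Exports.
From mathcomp Require Import fintype finset.

Local Open Scope ring_scope.

(** * Laws on a finite abelian group *)

(** The event is first moved to a finite level. Let [#|B| = p ^ N]. The lattice of relations of a
    generating tuple [b] contains p^N Z_p^n, so by Nakayama's argument ([padic_kernel_eq_image])
    whether the columns of [X] span it depends only on [X] modulo p^(N+1). By [card_presents] the
    probability sought is then the mean of [presentation_count] divided by [#|Aut B|].

    If [b] kills [X], the forms modulo [p] on the lattice that kill [X] make up an F_p-space of some
    dimension r, and the columns span iff r = 0. Möbius inversion over subspaces, truncated
    ([bonferroni_bound]), recovers this indicator from the numbers of independent families of k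
    forms, with an error at most the first omitted term. So only the means of [dual_moment] matter,
    for k fixed while n grows.

    Such a mean is a sum, over about |B|^n p^(kn) tuples of B x (Z/p^(N+1))^k with span of order |B|
    p^k, of the probability that the tuple kills [X]. By [tuple_sum_vanishes], replacing each
    probability by (|B| p^k)^-(n+u) costs o(1) in total, uniformly in the laws of the entries; the
    limit is |B|^-u p^(-uk). The estimate rests on a Doeblin minorization for tuples robust under
    deletions ([comb_law_equidistributed]) and on a gain of [1 - eps] per column for the others
    ([column_law_degenerate]).

    The limiting moments turn the truncated inversion into a partial sum of Euler's series
    ([euler_limit_bound]). A large truncation order, and then a large n, conclude
    ([presentation_count_limit]). *)

Section Convolution.
Variables (R : realType) (G : finZmodType).
Implicit Types (f g h : {ffun G -> R}).

Definition conv f g : {ffun G -> R} := [ffun y => \sum_x f x * g (y - x)].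

Definition dirac_ffun (a : G) : {ffun G -> R} := [ffun y => (y == a)%:R].

Lemma conv_dirac a f y : conv (dirac_ffun a) f y = f (y - a).
Proof.
rewrite ffunE (bigD1 a) //= big1 ?addr0 => [|x /negPf xa].
  by rewrite ffunE eqxx mul1r.
by rewrite ffunE xa mul0r.
Qed.

Lemma convC : commutative conv.
Proof.
move=> f g; apply/ffunP => y; rewrite !ffunE.
rewrite (reindex_inj (subrI y)) /=; apply: eq_bigr => x _.
by rewrite subKr mulrC.
Qed.

Lemma convA : associative conv.
Proof.
move=> f g h; apply/ffunP => y; rewrite !ffunE.
under eq_bigr => x _ do rewrite ffunE mulr_sumr.
under [RHS]eq_bigr => x _ do rewrite ffunE mulr_suml.
rewrite [RHS]exchange_big /=; apply: eq_bigr => x _.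
rewrite [RHS](reindex_inj (addIr x)) /=; apply: eq_bigr => z _.
by rewrite addrK mulrA opprD addrA [y - z - x]addrAC.
Qed.

Lemma conv0f : left_id (dirac_ffun 0) conv.
Proof. by move=> f; apply/ffunP => y; rewrite conv_dirac subr0. Qed.

Lemma conv_zero : left_zero 0 conv.
Proof.
move=> f; apply/ffunP => y; rewrite !ffunE big1 // => x _.
by rewrite ffunE mul0r.
Qed.

Lemma convDl : left_distributive conv +%R.
Proof.
move=> f g h; apply/ffunP => y; rewrite !ffunE -big_split /=.
by apply: eq_bigr => x _; rewrite ffunE mulrDl.
Qed.

HB.instance Definition _ := Monoid.isComLaw.Build {ffun G -> R}
  (dirac_ffun 0) conv convA convC conv0f.

Lemma convf_zero : right_zero 0 conv.
Proof. by move=> f; rewrite convC conv_zero. Qed.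

HB.instance Definition _ := Monoid.isMulLaw.Build {ffun G -> R}
  0 conv conv_zero convf_zero.

Lemma convDr : right_distributive conv +%R.
Proof. by move=> f g h; rewrite convC convDl !(convC _ f). Qed.

(* A copy of [+%R], which already carries the distributivity law of [*%R]. *)
Definition ffun_add f g := f + g.

HB.instance Definition _ := Monoid.isComLaw.Build {ffun G -> R}
  0 ffun_add (@addrA _) (@addrC _) (@add0r _).

HB.instance Definition _ := Monoid.isAddLaw.Build {ffun G -> R}
  conv ffun_add convDl convDr.

(** Laws form a commutative semiring under addition and convolution, so the generic expansion of a
    product of sums applies. *)
Lemma conv_bigA_distr (I T : finType) (F : I -> T -> {ffun G -> R}) :
  \big[conv/dirac_ffun 0]_i (\sum_t F i t) =
  \sum_(x : {ffun I -> T}) \big[conv/dirac_ffun 0]_i F i (x i).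
Proof. exact: (@bigA_distr_bigA _ 0 (dirac_ffun 0) conv ffun_add). Qed.

Definition is_law f := (forall x, 0 <= f x) /\ \sum_x f x = 1.

Lemma is_law_dirac a : is_law (dirac_ffun a).
Proof.
split=> [x|]; first by rewrite ffunE ler0n.
rewrite (bigD1 a) //= ffunE eqxx big1 ?addr0 // => x /negPf xa.
by rewrite ffunE xa.
Qed.

Lemma is_law_conv f g : is_law f -> is_law g -> is_law (conv f g).
Proof.
move=> [f0 f1] [g0 g1]; split=> [y|].
  by rewrite ffunE sumr_ge0 // => x _; rewrite mulr_ge0.
under eq_bigr do rewrite ffunE.
rewrite exchange_big /= -[RHS]f1; apply: eq_bigr => x _.
by rewrite -mulr_sumr (reindex_inj (addIr x)) /=; under eq_bigr do rewrite addrK;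
  rewrite g1 mulr1.
Qed.

Lemma is_law_big (I : finType) (S : {set I}) (nu : I -> {ffun G -> R}) :
  (forall i, is_law (nu i)) -> is_law (\big[conv/dirac_ffun 0]_(i in S) nu i).
Proof.
by move=> nuP; apply: big_ind => //; [exact: is_law_dirac|exact: is_law_conv].
Qed.

Definition supported (H : {set G}) f := forall x, x \notin H -> f x = 0.

Lemma sum_supported (H : {set G}) f : supported H f ->
  \sum_(x in H) f x = \sum_x f x.
Proof.
by move=> fH; rewrite big_mkcond; apply: eq_bigr => x _; case: ifPn => // /fH.
Qed.

Lemma supported_conv (H : {group G}) f g :
  supported H f -> supported H g -> supported H (conv f g).
Proof.
move=> fH gH y yH; rewrite ffunE big1 // => x _.
have [xH|/fH->] := boolP (x \in H); last by rewrite mul0r.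
rewrite gH ?mulr0 //; apply: contra yH => yxH.
by rewrite -[y](subrK x) -FinRing.zmodMgE groupM.
Qed.

Lemma supported_big (I : finType) (S : {set I}) (nu : I -> {ffun G -> R})
    (H : {group G}) :
  (forall i, i \in S -> supported H (nu i)) ->
  supported H (\big[conv/dirac_ffun 0]_(i in S) nu i).
Proof.
move=> nuH; apply: big_ind => //; last exact: supported_conv.
by move=> x; rewrite ffunE; case: eqP => // ->; rewrite group1.
Qed.

End Convolution.

(* [v t] is the integer attached to an outcome [t : T]. *)
Section RandomMultiples.
Variables (R : realType) (G : finZmodType) (T : finType) (v : T -> nat).

Definition mulrn_law (q : T -> R) (a : G) : {ffun G -> R} :=
  [ffun y => \sum_(t | a *+ v t == y) q t].

Lemma mulrn_lawE q a :
  mulrn_law q a = \sum_t [ffun y => q t * dirac_ffun R (a *+ v t) y].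
Proof.
apply/ffunP => y; rewrite sum_ffunE ffunE big_mkcond /=.
by apply: eq_bigr => t _; rewrite !ffunE eq_sym; case: eqP; rewrite ?mulr0 ?mulr1.
Qed.

Lemma is_law_mulrn q a : (forall t, 0 <= q t) -> \sum_t q t = 1 ->
  is_law (mulrn_law q a).
Proof.
move=> q0 q1; split=> [x|]; first by rewrite ffunE sumr_ge0.
under eq_bigr do rewrite ffunE.
by rewrite -[RHS]q1 (partition_big (fun t => a *+ v t) xpredT).
Qed.

Lemma supported_mulrn q a (H : {group G}) : a \in H ->
  supported H (mulrn_law q a).
Proof.
move=> aH y yH; rewrite ffunE big1 // => t /eqP ty.
by case/negP: yH; rewrite -ty -FinRing.zmodXgE groupX.
Qed.

Variables (I : finType) (q : I -> T -> R) (b : I -> G).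

Definition comb_law (S : {set I}) : {ffun G -> R} :=
  \big[@conv R G/dirac_ffun R 0]_(i in S) mulrn_law (q i) (b i).

Lemma comb_lawU (S1 S2 : {set I}) : [disjoint S1 & S2] ->
  comb_law (S1 :|: S2) = conv (comb_law S1) (comb_law S2).
Proof. by move=> dS; rewrite /comb_law -bigU //; apply: eq_bigl => i; rewrite !inE. Qed.

Lemma comb_law1 i : comb_law [set i]%SET = mulrn_law (q i) (b i).
Proof. by rewrite /comb_law big_set1. Qed.

Lemma comb_law0 : comb_law finset.set0 = dirac_ffun R 0.
Proof. by rewrite /comb_law big_set0. Qed.

(** This ties convolution to independence: [comb_law] is the law of the combination of the [b i]
    whose coefficients are drawn independently. *)
Lemma comb_lawE y :
  comb_law [set: I]%SET y =
  \sum_(x : {ffun I -> T} | \sum_i b i *+ v (x i) == y) \prod_i q i (x i).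
Proof.
rewrite /comb_law; under eq_bigl do rewrite inE.
under eq_bigr do rewrite mulrn_lawE.
rewrite conv_bigA_distr /= sum_ffunE [RHS]big_mkcond; apply: eq_bigr => x _.
suff -> : \big[@conv R G/dirac_ffun R 0]_i
    [ffun z => q i (x i) * dirac_ffun R (b i *+ v (x i)) z]
    = [ffun z => (\prod_i q i (x i)) * dirac_ffun R (\sum_i b i *+ v (x i)) z].
  by rewrite !ffunE eq_sym; case: eqP; rewrite ?mulr0 ?mulr1.
elim/big_rec3: _ => [|i z r f _ ->]; first by apply/ffunP => z; rewrite !ffunE mul1r.
apply/ffunP => w; rewrite !ffunE (bigD1 (b i *+ v (x i))) //= big1 ?addr0.
  by rewrite !ffunE eqxx mulr1 mulrA subr_eq [z + _]addrC.
by move=> c /negPf cN; rewrite !ffunE cN mulr0 mul0r.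
Qed.

End RandomMultiples.

(** * Equidistribution of random combinations *)

(** In a p-group, a multiple of [a] by an integer prime to [p] generates the same cyclic group as
    [a]. *)
Lemma mem_mulrn_coprime (p : nat) (G : finZmodType) (H : {group G}) (a : G) k :
  (p.-group [set: G]%G)%g -> coprime p k -> a *+ k \in H -> a \in H.
Proof.
move=> pG cpk akH.
have [e oa] := p_natP (mem_p_elt pG (in_setT a)).
have /eqP cyc : (generator <[a]> (a ^+ k))%g.
  by rewrite generator_coprime oa coprimeXl.
by rewrite -cycle_subG cyc cycle_subG.
Qed.

Lemma group_set_stab (G : finZmodType) (A : {set G}) :
  group_set [set g | [forall h in A, h + g \in A]]%SET.
Proof.
apply/group_setP; split=> [|g1 g2].
  by rewrite inE; apply/forall_inP => h hA; rewrite FinRing.zmod1gE addr0.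
rewrite !inE => /forall_inP Ag1 /forall_inP Ag2; apply/forall_inP => h hA.
by rewrite FinRing.zmodMgE addrA Ag2 ?Ag1.
Qed.

Section Doeblin.
Variables (R : realType) (p : nat) (G : finZmodType) (T I : finType).
Variables (v : T -> nat) (q : I -> T -> R) (b : I -> G) (eps : R).
Hypothesis p_prime : prime p.
Hypothesis pG : (p.-group [set: G]%G)%g.
Hypothesis eps_gt0 : 0 < eps.
Hypothesis eps_le1 : eps <= 1.
Hypothesis T_gt0 : (0 < #|T|)%N.
Hypothesis q_ge0 : forall i t, 0 <= q i t.
Hypothesis q_sum1 : forall i, \sum_t q i t = 1.
Hypothesis q_balanced :
  forall i r, \sum_(t | v t == r %[mod p]) q i t <= 1 - eps.

Local Notation law := (comb_law v q b).
Local Notation gen S := (<<(b @: S)%SET>>%G).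

Lemma is_law_comb S : is_law (law S).
Proof. by apply: is_law_big => i; apply: is_law_mulrn. Qed.

Lemma supported_comb (H : {group G}) (S : {set I}) :
  (forall i, i \in S -> b i \in H) -> supported H (law S).
Proof. by move=> bH; apply: supported_big => i /bH; apply: supported_mulrn. Qed.

Lemma gen_mem (S : {set I}) i : i \in S -> b i \in gen S.
Proof. by move=> iS; rewrite mem_gen ?imset_f. Qed.

Lemma gen_sub (H : {group G}) (S : {set I}) :
  (forall i, i \in S -> b i \in H) -> gen S \subset H.
Proof.
by move=> bH; rewrite gen_subG; apply/subsetP => _ /imsetP[i iS ->]; exact: bH.
Qed.

(** The two points differ by [a] times an integer prime to [p]. Hence, for [a] outside [H], at most
    one residue class of coefficients leads into [H]. *)
Lemma coprime_shift r (H : {group G}) (a g : G) t t' :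
  v t = r %[mod p] -> v t' != r %[mod p] ->
  g + a *+ v t \in H -> g + a *+ v t' \in H -> a \in H.
Proof.
move=> vt vt'; have co : v t != v t' %[mod p].
  by rewrite vt eq_sym.
wlog le : t t' {vt vt'} co / (v t <= v t')%N.
  have [le|lt] := leqP (v t) (v t'); first by apply.
  by move=> W h1 h2; apply: (W t' t); rewrite // 1?eq_sym // ltnW.
move=> h1 h2; apply: (@mem_mulrn_coprime p G H a (v t' - v t)) => //.
  by rewrite prime_coprime // -eqn_mod_dvd // eq_sym.
have -> : a *+ (v t' - v t) = g + a *+ v t' - (g + a *+ v t).
  by rewrite mulrnBr // opprD addrACA subrr add0r.
by rewrite -FinRing.zmodVgE -FinRing.zmodMgE groupM ?groupV.
Qed.

Definition atom_bound : R := eps / #|T|%:R.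
Local Notation c := atom_bound.

Lemma atom_bound_gt0 : 0 < c.
Proof. by rewrite divr_gt0 ?ltr0n. Qed.

Lemma atom_bound_le1 : c <= 1.
Proof.
by rewrite ler_pdivrMr ?ltr0n // mul1r (le_trans eps_le1) // ler1n.
Qed.

Lemma large_atom i (Q : pred T) (s : R) :
  s <= \sum_(t | Q t) q i t -> 0 < s -> exists2 t, Q t & s / #|T|%:R <= q i t.
Proof.
move=> sQ s0; apply/exists_inP; rewrite -[X in is_true X]negbK negb_exists_in.
apply/negP => /forall_inP small.
have : \sum_(t | Q t) q i t < s; last by rewrite ltNge sQ.
have [t Qt] : exists t, Q t.
  apply/existsP; rewrite -[X in is_true X]negbK negb_exists; apply/negP => /forallP nQ.
  by move: sQ; rewrite big1 ?leNgt ?s0 // => t; rewrite (negPf (nQ t)).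
apply: (@lt_le_trans _ _ (\sum_(t | Q t) s / #|T|%:R)).
  apply: Num.Theory.ltr_sum => [|s' /small]; last by rewrite ltNge.
  by apply/hasP; exists t; rewrite ?mem_index_enum.
rewrite sumr_const -[leLHS]mulr_natr -mulrA ger_pMr // mulrC ler_pdivrMr ?ltr0n //.
by rewrite mul1r ler_nat max_card.
Qed.

(** Pigeonhole over [T], twice: on the total mass 1, then on the mass, at least [eps], that lies
    outside the residue class of the first atom. *)
Lemma two_atoms i :
  exists t t', [/\ v t != v t' %[mod p], c <= q i t & c <= q i t'].
Proof.
have [|//|t _ qt] := @large_atom i xpredT 1; first by rewrite q_sum1.
have [||t' vt' qt'] := @large_atom i [pred t' | v t' != v t %[mod p]] eps => //.
  have := q_balanced i (v t); rewrite -(q_sum1 i).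
  rewrite [X in _ <= X - _](bigID (fun t1 => v t1 == v t %[mod p])) /=.
  by rewrite -addrA lerDl subr_ge0.
exists t, t'; split=> //; first by rewrite eq_sym.
by apply: le_trans qt; rewrite ler_wpM2r ?invr_ge0 ?eps_le1.
Qed.

(** The threshold loses one factor [c] per index, which is the price of fixing one coefficient at an
    atom given by [two_atoms]. *)
Definition heavy (S : {set I}) : {set G} :=
  [set h | c ^+ #|S| <= law S h]%SET.

Lemma heavy_add (S : {set I}) i t h : i \notin S -> c <= q i t ->
  h \in heavy S -> h + b i *+ v t \in heavy (i |: S).
Proof.
move=> iS qt; rewrite !inE cardsU1 iS exprS => hS.
have c0 := ltW atom_bound_gt0.
rewrite comb_lawU ?disjoints1 // comb_law1 ffunE (bigD1 (b i *+ v t)) //=.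
rewrite addrK -[leLHS]addr0; apply: lerD; last first.
  by apply: sumr_ge0 => x _; rewrite mulr_ge0 ?(is_law_mulrn _ _ _ _).1
     ?(is_law_comb S).1.
apply: ler_pM => //; first exact: exprn_ge0.
apply: le_trans qt _; rewrite ffunE (bigD1 t) //= lerDl.
exact: sumr_ge0.
Qed.

(* If no index outside [S] enlarged the set of heavy points, that set would be *)
(* stable under the subgroup that these indices generate.                      *)
Lemma heavy_grow (S S' : {set I}) (H : {group G}) :
  S \subset S' -> gen (S' :\: S) = H -> heavy S != finset.set0 ->
  (#|heavy S| < #|H|)%N ->
  exists2 i, i \in S' :\: S & (#|heavy S| < #|heavy (i |: S)|)%N.
Proof.
move=> SS' genH /set0Pn[h0 h0A]; rewrite ltnNge => /negP small.
apply/exists_inP; rewrite -[X in is_true X]negbK negb_exists_in.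
apply/negP => /forall_inP bad; apply: small.
pose St := Group (group_set_stab (heavy S)).
have HSt : H \subset St.
  rewrite -genH; apply: gen_sub => i iS.
  have [t [t' [vtt' qt qt']]] := two_atoms i.
  have iNS : i \notin S by move: iS; rewrite inE => /andP[].
  (* By [heavy_add] a translate of [heavy S] lies in [heavy (i |: S)]; as the latter is no larger,
     they coincide. Two coefficients distinct modulo [p] thus give the same translate, and their
     difference times [b i] stabilizes [heavy S]. *)
  have shift s : c <= q i s ->
      (fun h => h + b i *+ v s) @: heavy S = heavy (i |: S).
    move=> qs; apply/eqP; rewrite eqEcard; apply/andP; split.
      by apply/subsetP => _ /imsetP[h hA ->]; exact: heavy_add.
    by rewrite card_imset; [rewrite leqNgt bad | exact: addIr].
  wlog le : t t' vtt' qt qt' / (v t <= v t')%N.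
    have [le|lt] := leqP (v t) (v t'); first by move=> W; exact: (W t t').
    by move=> W; apply: (W t' t) => //; [rewrite eq_sym | exact: ltnW].
  apply: (@mem_mulrn_coprime p _ _ _ (v t' - v t)) => //.
    by rewrite prime_coprime // -eqn_mod_dvd // eq_sym.
  rewrite inE; apply/forall_inP => h hA.
  have : h + b i *+ v t' \in heavy (i |: S) by apply: heavy_add.
  rewrite -(shift t qt) => /imsetP[h' h'A e].
  suff -> : h + b i *+ (v t' - v t) = h' by exact: h'A.
  by rewrite mulrnBr // addrA e addrK.
(* A nonempty set stable under [H] contains a translate of [H]. *)
have -> : #|H| = #|[set h0 + g | g in H]%SET| by rewrite card_imset //; exact: addrI.
apply: subset_leq_card; apply/subsetP => _ /imsetP[g gH ->].
by have := subsetP HSt g gH; rewrite inE => /forall_inP; apply.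
Qed.

(** Greedy choice: the empty block has the heavy point 0, and [heavy_grow] adds indices, each
    gaining a heavy point, until all of [H] is heavy. Fewer than [#|H|] indices are removed on the
    way, so the remaining ones still generate [H]. *)
Lemma heavy_block (S : {set I}) (H : {group G}) :
  (forall tau : {set I}, (#|tau| < #|H|)%N -> gen (S :\: tau) = H) ->
  exists beta : {set I}, [/\ beta \subset S, (#|beta| < #|H|)%N &
    forall h, h \in H -> c ^+ #|G| <= law beta h].
Proof.
move=> robust.
have grow j : (j < #|H|)%N -> exists beta : {set I},
    [/\ beta \subset S, (#|beta| <= j)%N & (j < #|heavy beta|)%N].
  elim: j => [_|j IH jH].
    exists finset.set0; rewrite sub0set cards0; split=> //.
    apply/card_gt0P; exists 0.
    by rewrite inE cards0 comb_law0 ffunE eqxx.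
  have [beta [bS bj jb]] := IH (ltnW jH).
  have [lt|ge] := ltnP j.+1 #|heavy beta|.
    by exists beta; split=> //; apply: leq_trans bj _.
  have [||i iS grow] := heavy_grow bS (robust beta (leq_ltn_trans bj (ltnW jH))).
  - by rewrite -card_gt0 (leq_trans _ jb).
  - exact: leq_ltn_trans ge jH.
  exists (i |: beta); split.
  - by move: iS; rewrite inE => /andP[_ iS]; rewrite subUset sub1set iS.
  - by rewrite cardsU1 (leq_trans (leq_add (leq_b1 _) bj)).
  - exact: leq_ltn_trans jb grow.
have H0 := cardG_gt0 H.
have [|beta [bS bH Hb]] := grow #|H|.-1; first by rewrite prednK.
exists beta; rewrite prednK // in Hb; split=> //; first by rewrite -(prednK H0).
have b_in i : i \in beta -> b i \in H.
  by move=> ib; rewrite -(robust finset.set0) ?cards0 // setD0 gen_mem ?(subsetP bS).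
move=> h hH.
have hb : heavy beta = H.
  apply/eqP; rewrite eqEcard Hb andbT; apply/subsetP => x; rewrite inE.
  apply: contraTT => xH; rewrite (supported_comb b_in) // -ltNge exprn_gt0 //.
  exact: atom_bound_gt0.
have : h \in heavy beta by rewrite hb.
rewrite inE; apply: le_trans; apply: ler_wiXn2l.
- exact: ltW atom_bound_gt0.
- exact: atom_bound_le1.
- by rewrite (leq_trans bH) // (leq_trans (leq_pred _)) ?max_card.
Qed.


Lemma comb_lawD (beta S : {set I}) : beta \subset S ->
  law S = conv (law beta) (law (S :\: beta)).
Proof.
move=> bS; rewrite -comb_lawU; last first.
  by rewrite disjoints_subset; apply/subsetP => x xb; rewrite !inE xb.
by congr comb_law; rewrite -{1}(setID S beta) (setIidPr bS).
Qed.

Definition mixing_rate : R := 1 - c ^+ #|G|.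
Local Notation rho := mixing_rate.

Lemma mixing_rate_ge0 : 0 <= rho.
Proof. by rewrite subr_ge0 exprn_ile1 ?atom_bound_le1 // ltW ?atom_bound_gt0. Qed.

Lemma mixing_rate_lt1 : rho < 1.
Proof. by rewrite gtrBl exprn_gt0 ?atom_bound_gt0. Qed.

(** Doeblin's argument, by peeling off one block at a time: a block charges every point of [H] with
    at least [c ^+ #|G|], and convolution with this constant part annihilates the deviation from
    uniformity. Each block uses at most [#|G|] of the allowed deletions. *)
Lemma comb_law_equidistributed k (S : {set I}) (H : {group G}) :
  (forall tau : {set I}, (#|tau| < k * #|G|)%N -> gen (S :\: tau) = H) ->
  gen S = H ->
  forall h, h \in H -> `|law S h - #|H|%:R^-1| <= rho ^+ k.
Proof.
have H0 : 0 < (#|H|%:R : R) by rewrite ltr0n cardG_gt0.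
have invH : #|H|%:R^-1 <= 1 :> R by rewrite invf_le1 // ler1n cardG_gt0.
elim: k S => [|k IH] S robust genS h hH.
  have law_le1 : law S h <= 1.
    rewrite -(is_law_comb S).2 (bigD1 h) //= lerDl sumr_ge0 // => x _.
    exact: (is_law_comb S).1.
  have := (is_law_comb S).1 h; have := invr_ge0 (#|H|%:R : R); rewrite (ltW H0) => i0 l0.
  by rewrite expr0 ler_norml; apply/andP; split; lra.
have [|beta [bS bH hb]] := @heavy_block S H.
  move=> tau tH; apply: robust; rewrite (leq_trans tH) // mulSn.
  by rewrite (leq_trans (max_card _)) ?leq_addr.
have robust' (tau : {set I}) : (#|tau| < k * #|G|)%N -> gen ((S :\: beta) :\: tau) = H.
  move=> tk; rewrite setDDl; apply: robust.
  rewrite (leq_ltn_trans (leq_card_setU _ _)) // mulSn.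
  by rewrite -addnS leq_add // ltnW // (leq_trans bH) // max_card.
have genS' : gen (S :\: beta) = H.
  apply: robust; rewrite (leq_trans bH) // mulSn.
  by rewrite (leq_trans (max_card _)) ?leq_addr.
have bin i : i \in S -> b i \in H by move=> iS; rewrite -genS gen_mem.
have sb : supported H (law beta).
  by apply: supported_comb => i /(subsetP bS)/bin.
have sS' : supported H (law (S :\: beta)).
  by apply: supported_comb => i; rewrite inE => /andP[_ /bin].
have sum_beta : \sum_(x in H) law beta x = 1.
  by rewrite sum_supported // (is_law_comb beta).2.
have sum_S' : \sum_(x in H) (law (S :\: beta) (h - x) - #|H|%:R^-1) = 0.
  rewrite sumrB sumr_const -[X in _ - X]mulr_natr mulVf ?gt_eqF //.
  rewrite (reindex_inj (subrI h)) /= -[X in _ = X](subrr 1); congr (_ - 1).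
  under eq_bigr do rewrite subKr.
  rewrite -[RHS](is_law_comb (S :\: beta)).2 -(sum_supported sS').
  apply: eq_bigl => x.
  by rewrite -FinRing.zmodVgE -FinRing.zmodMgE groupMl // groupV.
(* The constant [c ^+ #|G|] may be subtracted freely, since the deviations of the second factor sum
   to 0 over [H]; the remaining weights are nonnegative with total at most [rho]. *)
have -> : law S h - #|H|%:R^-1 =
    \sum_(x in H) (law beta x - c ^+ #|G|) * (law (S :\: beta) (h - x) - #|H|%:R^-1).
  under eq_bigr do rewrite mulrBl.
  rewrite sumrB -mulr_sumr sum_S' mulr0 subr0.
  under eq_bigr do rewrite mulrBr.
  rewrite sumrB -mulr_suml sum_beta mul1r; congr (_ - _).
  rewrite (comb_lawD bS) ffunE [RHS]big_mkcond; apply: eq_bigr => x _.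
  by case: ifPn => // /sb ->; rewrite mul0r.
apply: le_trans (ler_norm_sum _ _ _) _.
apply: (@le_trans _ _ (\sum_(x in H) (law beta x - c ^+ #|G|) * rho ^+ k)).
  apply: ler_sum => x xH; rewrite normrM ger0_norm ?subr_ge0 ?hb //.
  apply: ler_wpM2l; first by rewrite subr_ge0 hb.
  apply: IH => //.
  by rewrite -FinRing.zmodVgE -FinRing.zmodMgE groupM ?groupV.
rewrite -mulr_suml sumrB sum_beta exprS; apply: ler_wpM2r.
  exact: exprn_ge0 mixing_rate_ge0.
rewrite lerD2l lerN2 sumr_const -[leRHS]mulr_natr ler_peMr //.
  by rewrite exprn_ge0 ?ltW ?atom_bound_gt0.
by rewrite ler1n cardG_gt0.
Qed.



Lemma gen_mono (S1 S2 : {set I}) : S1 \subset S2 -> gen S1 \subset gen S2.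
Proof. by move=> S12; apply: gen_sub => i /(subsetP S12); exact: gen_mem. Qed.

Definition robust_compl K (sigma : {set I}) :=
  forall tau : {set I}, (#|tau| < K)%N -> gen (~: sigma :\: tau) = gen (~: sigma).

(* A minimizer of [K * #|gen (~: sigma)| + #|sigma|] works: deleting a small   *)
(* [tau] in a way that shrinks the subgroup would lower this quantity.         *)
Lemma robust_compl_exists K :
  exists2 sigma : {set I}, (#|sigma| <= K * #|G|)%N & robust_compl K sigma.
Proof.
pose Phi (sigma : {set I}) := (K * #|gen (~: sigma)| + #|sigma|)%N.
case: (arg_minnP Phi (isT : xpredT (set0 : {set I}))) => sigma _ smin.
exists sigma.
  have := smin set0 isT; rewrite /Phi cards0 addn0 => le.
  rewrite (leq_trans (leq_trans (leq_addl _ _) le)) // leq_mul2l.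
  by rewrite max_card orbT.
move=> tau tK; apply: val_inj; apply/eqP; rewrite eqEcard gen_mono ?subsetDl //=.
rewrite leqNgt; apply/negP => lt.
have := leq_mul (leqnn K) lt; rewrite mulnS => le1.
have := smin (sigma :|: tau) isT; rewrite /Phi setCU -setDE => le2.
have : (#|sigma| + K <= #|sigma| + #|tau|)%N; last by rewrite leq_add2l leqNgt tK.
rewrite -(leq_add2l (K * #|gen (~: sigma :\: tau)|)).
apply: leq_trans (leq_trans le2 _); first by rewrite addnCA [leqRHS]addnC leq_add2l addnC.
by rewrite leq_add2l leq_card_setU.
Qed.

(** Robustness passes from the complement of [sigma] to all indices, because both generate the same
    subgroup. *)
Lemma column_law_spread K k sigma : robust_compl K sigma -> (k * #|G| <= K)%N ->
  gen (~: sigma) = gen [set: I] ->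
  `|law [set: I] 0 - #|gen [set: I]|%:R^-1| <= rho ^+ k.
Proof.
move=> rob kK genT.
apply: comb_law_equidistributed => [tau tk|//|]; last exact: group1.
have : gen (~: sigma) \subset gen ([set: I] :\: tau).
  by rewrite -(rob tau) ?(leq_trans tk) // gen_mono // setSD ?subsetT.
rewrite genT => sub; apply: val_inj; apply/eqP.
by rewrite eqEsubset gen_mono ?subsetDl.
Qed.

(* Some [b i] with [i] in [sigma] lies outside [gen (~: sigma)]; for the sum   *)
(* over [sigma] to fall back into that subgroup, the residue of the [i]-th     *)
(* coefficient modulo [p] is forced by the others.                             *)
Lemma column_law_degenerate K k sigma :
  robust_compl K sigma -> (k * #|G| <= K)%N ->
  gen (~: sigma) != gen [set: I] ->
  law [set: I] 0 <= (1 - eps) * (#|gen (~: sigma)|%:R^-1 + rho ^+ k).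
Proof.
move=> rob kK; set H := gen (~: sigma) => HT.
have [i isig biH] : exists2 i, i \in sigma & b i \notin H.
  apply/exists_inP; rewrite -[X in is_true X]negbK negb_exists_in.
  apply: contra HT => /forall_inP bH; rewrite -val_eqE /= eqEsubset gen_mono ?subsetT //=.
  apply: gen_sub => i _; have [/bH|iN] := boolP (i \in sigma); first by rewrite negbK.
  by apply: gen_mem; rewrite inE.
have lawH h : law (~: sigma) h <= if h \in H then #|H|%:R^-1 + rho ^+ k else 0.
  case: ifP => hH.
    have : `|law (~: sigma) h - #|H|%:R^-1| <= rho ^+ k.
      apply: comb_law_equidistributed => // tau tk; apply: rob.
      exact: leq_trans tk kK.
    by rewrite ler_distl => /andP[_]; rewrite addrC.
  by rewrite (@supported_comb H) ?hH // => j; exact: gen_mem.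
have bound0 : 0 <= #|H|%:R^-1 + rho ^+ k.
  by rewrite addr_ge0 ?invr_ge0 ?exprn_ge0 ?mixing_rate_ge0.
(* Condition on the coefficients of [sigma] other than the [i]-th: those values of the [i]-th one
   that lead into [H] lie in a single class modulo [p]. *)
have back : \sum_(x in H) law sigma x <= 1 - eps.
  rewrite (@comb_lawD [set i]%SET sigma) ?sub1set // comb_law1 convC.
  under eq_bigr do rewrite ffunE.
  rewrite exchange_big /= -[leRHS]mul1r.
  rewrite -[X in X * _](is_law_comb (sigma :\: [set i]%SET)).2 mulr_suml.
  apply: ler_sum => g _; rewrite -mulr_sumr; apply: ler_wpM2l.
    exact: (is_law_comb _).1.
  under eq_bigr do rewrite ffunE.
  rewrite (exchange_big_dep xpredT) //=.
  under eq_bigr do rewrite big_mkcond /=.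
  have -> : \sum_t \sum_x (if (x \in H) && (b i *+ v t == x - g) then q i t else 0)
     = \sum_(t | g + b i *+ v t \in H) q i t.
    rewrite [RHS]big_mkcond; apply: eq_bigr => t _.
    rewrite (bigD1 (g + b i *+ v t)) //= big1 ?addr0 => [|x xN].
      by rewrite [g + _]addrC addrK eqxx andbT.
    by rewrite eq_sym subr_eq [_ + g]addrC (negPf xN) andbF.
  have [|nex] := pselect (exists t, g + b i *+ v t \in H).
    move=> [t0 t0H]; apply: le_trans (q_balanced i (v t0)).
    rewrite [leLHS]big_mkcond [leRHS]big_mkcond; apply: ler_sum => t _.
    case: ifP => tH; last by case: ifP.
    case: ifP => // /negbT vt; case/negP: biH.
    exact: (@coprime_shift (v t0) H (b i) g t0 t).
  rewrite big1 ?subr_ge0 // => t tH; case: nex; by exists t.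
rewrite (@comb_lawD sigma) ?subsetT // setTD ffunE.
apply: (@le_trans _ _
    (\sum_x law sigma x * (if x \in H then #|H|%:R^-1 + rho ^+ k else 0))).
  apply: ler_sum => x _; apply: ler_wpM2l; first exact: (is_law_comb _).1.
  by have := lawH (0 - x); rewrite sub0r -FinRing.zmodVgE groupV.
rewrite (eq_bigr (fun x => (if x \in H then law sigma x else 0) * (#|H|%:R^-1 + rho ^+ k))).
  by rewrite -mulr_suml -big_mkcond ler_wpM2r.
by move=> x _; case: ifP; rewrite ?mulr0 ?mul0r.
Qed.

End Doeblin.

(** * Sums over all tuples *)

(** Telescoping, one factor at a time, with relative error [z] in each factor. *)
Lemma dist_prod_expr (R : realType) (J : finType) (l : J -> R) (h z : R) :
  0 <= h -> 0 <= z -> (forall j, 0 <= l j) ->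
  (forall j, `|l j - h| <= h * z) ->
  `|\prod_j l j - h ^+ #|J| | <= h ^+ #|J| * ((1 + z) ^+ #|J| - 1).
Proof.
move=> h0 z0 l0 lh; rewrite -!prodr_const.
suff : 0 <= \prod_(j : J) h /\ `|\prod_j l j - \prod_(j : J) h|
    <= \prod_(j : J) h * (\prod_(j : J) (1 + z) - 1) by case.
elim/big_rec3: _ => [|j S P Q _ [Q0 IH]]; first by rewrite !subrr normr0 mulr0.
split; first exact: mulr_ge0.
have -> : l j * P - h * Q = l j * (P - Q) + (l j - h) * Q by ring.
apply: le_trans (ler_normD _ _) _; rewrite !normrM (ger0_norm (l0 j)) (ger0_norm Q0).
have lj : l j <= h * (1 + z).
  by have := lh j; rewrite ler_distl => /andP[_]; rewrite mulrDr mulr1.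
apply: (@le_trans _ _ (h * (1 + z) * (Q * (S - 1)) + h * z * Q)).
  apply: lerD; last exact: ler_wpM2r.
  by apply: ler_pM => //; rewrite normr_ge0.
by rewrite le_eqVlt; apply/orP; left; apply/eqP; ring.
Qed.

Lemma sum_expr_card (R : realType) (I : finType) (x : R) :
  \sum_(A : {set I}) x ^+ #|A| = (1 + x) ^+ #|I|.
Proof.
rewrite addrC -[RHS]prodr_const bigA_distr; apply: eq_bigr => A _.
by rewrite -big_mkcond prodr_const.
Qed.

(** A Chernoff-type bound: for a small set, [a ^+ #|A|] is at most [x ^+ #|A| * y ^+ #|I|], and the
    binomial theorem sums the powers of [x] over all sets. *)
Lemma sum_small_sets (R : realType) (I : finType) (a x y : R) (D : nat) :
  0 <= a -> 0 <= x -> 1 <= y -> a <= x * y ^+ D ->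
  \sum_(A : {set I} | (D * #|A| <= #|I|)%N) a ^+ #|A| <= ((1 + x) * y) ^+ #|I|.
Proof.
move=> a0 x0 y1 axy; rewrite exprMn -sum_expr_card mulr_suml.
rewrite big_mkcond; apply: ler_sum => A _; have y0 := le_trans ler01 y1.
case: ifP => AD; last by rewrite mulr_ge0 ?exprn_ge0.
apply: (@le_trans _ _ ((x * y ^+ D) ^+ #|A|)).
  by rewrite lerXn2r ?nnegrE ?(le_trans a0).
rewrite exprMn -exprM; apply: ler_wpM2l; first exact: exprn_ge0.
exact: ler_weXn2l.
Qed.

(** Writing the indicator of the tuples with entries in [H] outside [A] as a product makes the count
    factor over the indices. *)
Lemma sum_ffun_restricted (R : realType) (I T : finType) (A : {set I}) (H : {set T}) :
  \sum_(b : {ffun I -> T}) \prod_i ((i \in A) || (b i \in H))%:R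
  = #|T|%:R ^+ #|A| * #|H|%:R ^+ #|~: A| :> R.
Proof.
rewrite -(bigA_distr_bigA (fun i t => ((i \in A) || (t \in H))%:R : R)) /=.
rewrite (bigID [in A]) /=; congr (_ * _).
  rewrite -prodr_const; apply: eq_bigr => i ->.
  by rewrite sumr_const.
rewrite -prodr_const; apply: eq_big => [i|i /negPf ->]; first by rewrite inE.
rewrite -[#|H|]sum1_card [X in _ = X%:R]big_mkcond natr_sum.
by apply: eq_bigr => t _ /=; case: (t \in H).
Qed.


Section TupleSum.
Variables (R : realType) (p : nat) (G : finZmodType) (T I J : finType).
Variables (v : T -> nat) (q : J -> I -> T -> R) (eps : R).
Hypothesis p_prime : prime p.
Hypothesis pG : (p.-group [set: G]%G)%g.
Hypothesis eps_gt0 : 0 < eps.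
Hypothesis eps_le : eps <= 2^-1.
Hypothesis T_gt0 : (0 < #|T|)%N.
Hypothesis q_ge0 : forall j i t, 0 <= q j i t.
Hypothesis q_sum1 : forall j i, \sum_t q j i t = 1.
Hypothesis q_balanced :
  forall j i r, \sum_(t | v t == r %[mod p]) q j i t <= 1 - eps.
Hypothesis IJ : (#|I| <= #|J|)%N.

Definition tuple_span (b : I -> G) : {group G} := <<(b @: [set: I])%SET>>%G.

Definition tuple_prob (b : I -> G) : R :=
  \prod_j comb_law v (q j) b [set: I] 0.

Let eps_le1 : eps <= 1. Proof. by move: eps_le; lra. Qed.

(* A tuple whose span survives the deletion of a small set contributes to the  *)
(* first sum. Otherwise, deleting some small set [A] leaves a proper subgroup  *)
(* [H], and each of the [#|J|] columns costs a factor [1 - eps]; this beats    *)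
(* the number of small sets [A].                                               *)
Lemma tuple_prob_bound K k (b : {ffun I -> G})
    (z := #|G|%:R * mixing_rate G T eps ^+ k) : (k * #|G| <= K)%N ->
  `|tuple_prob b - #|tuple_span b|%:R^-1 ^+ #|J| | <=
  \sum_(H : {group G}) (\prod_i ((i \in set0) || (b i \in H))%:R) *
      (#|H|%:R^-1 ^+ #|J| * ((1 + z) ^+ #|J| - 1)) +
  \sum_(A : {set I} | (#|A| <= K * #|G|)%N) \sum_(H : {group G})
     (\prod_i ((i \in A) || (b i \in H))%:R) *
     (((1 - eps) * (#|H|%:R^-1 * (1 + z))) ^+ #|J| *+ 2).
Proof.
move=> kK; set m := #|J|.
have rho0 : 0 <= mixing_rate G T eps ^+ k by rewrite exprn_ge0 // mixing_rate_ge0.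
have z0 : 0 <= z by rewrite mulr_ge0.
have e0 : 0 <= 1 - eps by rewrite subr_ge0.
have H0 (H : {group G}) : 0 < #|H|%:R :> R by rewrite ltr0n cardG_gt0.
have z1 : 0 <= (1 + z) ^+ m - 1 by rewrite subr_ge0 exprn_ege1 // lerDl.
have rhoz (H : {group G}) : mixing_rate G T eps ^+ k <= #|H|%:R^-1 * z.
  rewrite mulrC ler_pdivlMr // mulrC; apply: ler_wpM2r => //.
  by rewrite ler_nat max_card.
have w0 (H : {group G}) : 0 <= (1 - eps) * (#|H|%:R^-1 * (1 + z)).
  apply: mulr_ge0 => //; apply: mulr_ge0; first by rewrite invr_ge0.
  exact: addr_ge0.
have ind0 (A : {set I}) (H : {group G}) :
    0 <= \prod_i ((i \in A) || (b i \in H))%:R :> R by apply: prodr_ge0.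
have ind1 (A : {set I}) (H : {group G}) : (forall i, i \notin A -> b i \in H) ->
    \prod_i ((i \in A) || (b i \in H))%:R = 1 :> R.
  by move=> bH; rewrite big1 // => i _; case: (boolP (i \in A)) => //= /bH ->.
have term1 (H : {group G}) : 0 <= (\prod_i ((i \in set0) || (b i \in H))%:R) *
      (#|H|%:R^-1 ^+ m * ((1 + z) ^+ m - 1)).
  by rewrite mulr_ge0 // mulr_ge0 // exprn_ge0 // invr_ge0.
have term2 (A : {set I}) (H : {group G}) : 0 <= (\prod_i ((i \in A) || (b i \in H))%:R) *
     (((1 - eps) * (#|H|%:R^-1 * (1 + z))) ^+ m *+ 2).
  by apply: mulr_ge0 => //; apply: mulrn_wge0; apply: exprn_ge0.
have [sigma sK rob] := robust_compl_exists b K.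
have l0 j : 0 <= comb_law v (q j) b [set: I] 0.
  exact: (is_law_comb v b (q_ge0 j) (q_sum1 j) _).1.
have [genT|genN] := eqVneq <<(b @: (~: sigma))%SET>>%G (tuple_span b).
  rewrite -[leLHS]addr0; apply: lerD; last first.
    by apply: sumr_ge0 => A _; apply: sumr_ge0 => H _; exact: term2.
  rewrite (bigD1 (tuple_span b)) //= ind1 ?mul1r => [|i _]; last exact: gen_mem.
  rewrite -[leLHS]addr0; apply: lerD; last by rewrite sumr_ge0.
  apply: dist_prod_expr => // j; apply: le_trans (rhoz _).
  exact: (column_law_spread p_prime pG eps_gt0 eps_le1 T_gt0
    (q_ge0 j) (q_sum1 j) (q_balanced j) rob kK).
rewrite -[leLHS]add0r; apply: lerD; first by apply: sumr_ge0.
rewrite (bigD1 sigma) //= (bigD1 <<(b @: (~: sigma))%SET>>%G) //=.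
set H := <<_>>%G in genN *.
rewrite ind1 ?mul1r => [|i iA]; last by apply: gen_mem; rewrite inE.
rewrite -addrA -[leLHS]addr0; apply: lerD; last first.
  by rewrite addr_ge0 ?sumr_ge0 // => A _; rewrite sumr_ge0.
apply: le_trans (ler_normB _ _) _; rewrite mulr2n !ger0_norm; first last.
- exact: prodr_ge0.
- by rewrite exprn_ge0 // invr_ge0.
apply: lerD.
  rewrite -prodr_const; apply: ler_prod => j _; rewrite l0 /=.
  apply: le_trans (column_law_degenerate p_prime pG eps_gt0 eps_le1 T_gt0
    (q_ge0 j) (q_sum1 j) (q_balanced j) rob kK genN) _.
  by rewrite ler_wpM2l // mulrDr mulr1 lerD2l.
have sub : H \subset tuple_span b by rewrite gen_mono ?subsetT.
(* The uniform value must be small too. A proper subgroup has index at least 2, so this value is at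
   most half of [#|H|%:R^-1], and [eps <= 2^-1] lets the factor [1 - eps] absorb the half. *)
have dbl : (#|H| * 2 <= #|tuple_span b|)%N.
  rewrite -(Lagrange sub) leq_mul2l; apply/orP; right.
  rewrite ltn_neqAle eq_sym indexg_gt0 indexg_eq1 andbT.
  apply: contra genN => sub'; rewrite -val_eqE eqEsubset sub' andbT.
  exact: sub.
apply: lerXn2r; rewrite ?nnegrE ?invr_ge0 ?w0 //.
apply: (@le_trans _ _ (2^-1 * #|H|%:R^-1)).
  by rewrite -invfM lef_pV2 ?posrE ?mulr_gt0 // -natrM ler_nat mulnC.
apply: ler_pM => //; rewrite ?invr_ge0 //; first by move: eps_le; lra.
by rewrite ler_peMr ?invr_ge0 // lerDl.
Qed.


(** The number of tuples in [H] cancels against [#|H|%:R^-1 ^+ #|J|]. Freeing the entries in [A]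
    costs at most [#|G| ^ #|A|]. The condition on [D] is that of [sum_small_sets] with [x = eps / 4]
    and [y = 1 + eps / 4], so that all small sets together cost at most (1 + eps/4)^2 per index,
    less than what [1 - eps] gains. *)
Lemma tuple_sum_bound D (k := (#|I| %/ (D * #|G|) %/ #|G|)%N)
    (z := #|G|%:R * mixing_rate G T eps ^+ k) :
  #|G|%:R <= eps / 4 * (1 + eps / 4) ^+ D ->
  \sum_(b : {ffun I -> G})
     `|tuple_prob b - #|tuple_span b|%:R^-1 ^+ #|J| | <=
  #|{: {group G}}|%:R * ((1 + z) ^+ #|J| - 1) +
  #|{: {group G}}|%:R * (((1 - eps / 2) ^+ #|I| * (1 + z) ^+ #|J|) *+ 2).
Proof.
move=> GD; set K := (#|I| %/ (D * #|G|))%N.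
have kK : (k * #|G| <= K)%N by rewrite leq_divM.
have z0 : 0 <= z.
  by rewrite mulr_ge0 // exprn_ge0 // mixing_rate_ge0.
have e0 : 0 <= 1 - eps by rewrite subr_ge0.
have H1 (H : {group G}) : 1 <= #|H|%:R :> R by rewrite ler1n cardG_gt0.
have cancel (H : {group G}) a : (a <= #|J|)%N ->
    #|H|%:R ^+ a * #|H|%:R^-1 ^+ #|J| <= 1 :> R.
  move=> aJ; rewrite exprVn ler_pdivrMr ?exprn_gt0 ?mul1r ?(lt_le_trans ltr01) //.
  exact: ler_weXn2l.
apply: le_trans (ler_sum _ (fun b _ => tuple_prob_bound b kK)) _.
have sumc (c : R) : #|{: {group G}}|%:R * c = \sum_(H : {group G}) c.
  by rewrite sumr_const mulr_natl.
rewrite big_split /=; apply: lerD.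
  rewrite exchange_big sumc /=; apply: ler_sum => H _.
  rewrite -mulr_suml sum_ffun_restricted cards0 expr0 mul1r mulrA ler_piMl //.
    by rewrite subr_ge0 exprn_ege1 // lerDl.
  by apply: cancel; rewrite (leq_trans (max_card _)).
have ez : (1 + eps / 4) * (1 + eps / 4) * (1 - eps) <= 1 - eps / 2.
  have := eps_gt0; have := eps_le; nra.
have z1 : 0 <= 1 + z by exact: addr_ge0.
have p0 : 0 <= (1 + eps / 4) * (1 + eps / 4) by apply: mulr_ge0; move: eps_gt0; lra.
rewrite exchange_big /= sumc.
under eq_bigr do rewrite exchange_big /=.
apply: (@le_trans _ _ (\sum_(A : {set I} | (D * #|A| <= #|I|)%N) \sum_(H : {group G})
    #|G|%:R ^+ #|A| * (((1 - eps) ^+ #|I| * (1 + z) ^+ #|J|) *+ 2))).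
  rewrite [leLHS]big_mkcond [leRHS]big_mkcond; apply: ler_sum => A _.
  have rhs0 (H : {group G}) :
      0 <= #|G|%:R ^+ #|A| * (((1 - eps) ^+ #|I| * (1 + z) ^+ #|J|) *+ 2).
    by apply: mulr_ge0; [|apply: mulrn_wge0; apply: mulr_ge0]; apply: exprn_ge0.
  case: ifP => AK; last by case: ifP => // _; apply: sumr_ge0 => H _; exact: rhs0.
  have -> : (D * #|A| <= #|I|)%N.
    have /leq_trans -> // : (D * #|A| <= D * (K * #|G|))%N by rewrite leq_mul2l AK orbT.
    by rewrite mulnCA leq_divM.
  apply: ler_sum => H _; rewrite -mulr_suml sum_ffun_restricted -mulrA.
  apply: ler_wpM2l; first exact: exprn_ge0.
  rewrite mulrnAr; apply: ler_wMn2r; rewrite !exprMn.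
  have -> : #|H|%:R ^+ #|~: A| *
        ((1 - eps) ^+ #|J| * (#|H|%:R^-1 ^+ #|J| * (1 + z) ^+ #|J|)) =
      (#|H|%:R ^+ #|~: A| * #|H|%:R^-1 ^+ #|J|) *
        ((1 - eps) ^+ #|J| * (1 + z) ^+ #|J|) by ring.
  apply: le_trans (_ : (1 - eps) ^+ #|J| * (1 + z) ^+ #|J| <= _).
    apply: ler_piMl; first by apply: mulr_ge0; apply: exprn_ge0.
    by apply: cancel; rewrite (leq_trans (max_card _)).
  by rewrite ler_wpM2r ?exprn_ge0 // ler_wiXn2l // gerBl ltW.
rewrite exchange_big /=; apply: ler_sum => H _; rewrite -mulr_suml.
rewrite mulrnAr; apply: ler_wMn2r; rewrite mulrA.
apply: ler_wpM2r; first exact: exprn_ge0.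
apply: (@le_trans _ _ (((1 + eps / 4) * (1 + eps / 4)) ^+ #|I| * (1 - eps) ^+ #|I|)).
  apply: ler_wpM2r; first exact: exprn_ge0.
  by apply: sum_small_sets => //; move: eps_gt0; lra.
rewrite -exprMn; apply: lerXn2r; rewrite ?nnegrE //; first exact: mulr_ge0.
by move: eps_le; lra.
Qed.

End TupleSum.

Lemma expr_small (R : realType) (t eta : R) : 0 <= t < 1 -> 0 < eta ->
  exists n, t ^+ n <= eta.
Proof.
move=> /andP[t0 t1] eta0; have t1' : `|t| < 1 by rewrite ger0_norm.
have /cvgrPdist_le /(_ _ eta0) [n _ /(_ n (leqnn n))] := cvg_expr t1'.
by rewrite sub0r normrN ger0_norm ?exprn_ge0 //; exists n.
Qed.

(** The geometric sum up to exponent [k] has [k.+1] terms, each at least [t ^+ k]. *)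
Lemma mulrn_expr_le (R : realType) (t : R) k : 0 <= t < 1 ->
  t ^+ k *+ k.+1 <= (1 - t)^-1.
Proof.
move=> /andP[t0 t1]; rewrite -[leRHS]mul1r ler_pdivlMr ?subr_gt0 //.
apply: (@le_trans _ _ (1 - t ^+ k.+1)); last by rewrite gerBl exprn_ge0.
rewrite -[1 in leRHS](expr1n _ k.+1) subrXX mulrC.
apply: ler_wpM2l; first by rewrite subr_ge0 ltW.
rewrite -[k.+1 in leLHS]card_ord -sumr_const; apply: ler_sum => i _.
by rewrite expr1n mul1r ler_wiXn2l // ?ltW // -ltnS.
Qed.

Lemma cvg_expr_divn (R : realType) (t : R) d : (0 < d)%N -> 0 <= t < 1 ->
  ((fun n => t ^+ (n %/ d)) @ \oo --> (0 : R))%classic.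
Proof.
move=> d0 t01; apply/cvgrPdist_le => eta eta0.
have [m tm] := expr_small t01 eta0; have /andP[t0 t1] := t01.
exists (m * d)%N => //= n mn; rewrite sub0r normrN ger0_norm ?exprn_ge0 //.
by apply: le_trans tm; rewrite ler_wiXn2l ?(ltW t1) // leq_divRL.
Qed.

(** With [t = s ^+ 2], one power of [s] absorbs the linear growth and the other still tends to 0. *)
Lemma cvg_mulrn_expr_divn (R : realType) (t : R) d u : (0 < d)%N -> 0 <= t < 1 ->
  ((fun n => t ^+ (n %/ d) *+ (n + u)) @ \oo --> (0 : R))%classic.
Proof.
move=> d0 /andP[t0 t1]; set s := Num.sqrt t.
have s01 : 0 <= s < 1.
  by rewrite sqrtr_ge0 /= -sqrtr1 ltr_sqrt.
have [s0 s1] := andP s01.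
have c0 : ((fun n => s ^+ (n %/ d) * ((1 - s)^-1 *+ (d + u))) @ \oo --> (0 : R))%classic.
  rewrite -[X in (_ --> X)%classic](mul0r ((1 - s)^-1 *+ (d + u))).
  by apply: cvgM; [exact: cvg_expr_divn|exact: cvg_cst].
apply: (squeeze_cvgr _ (cvg_cst 0) c0); near=> n.
rewrite mulrn_wge0 ?exprn_ge0 //=; set k := (n %/ d)%N.
have nk : (n + u <= k.+1 * (d + u))%N.
  rewrite mulnDr leq_add //; first by rewrite ltnW // ltn_ceil.
  by rewrite leq_pmull.
apply: (@le_trans _ _ (t ^+ k *+ (k.+1 * (d + u)))).
  by apply: ler_wpMn2l => //; rewrite exprn_ge0.
rewrite -[t](sqr_sqrtr t0) -/s -exprM mulnC exprM expr2 -mulrnAr.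
apply: ler_wpM2l; first exact: exprn_ge0.
by rewrite mulrnA; apply: ler_wMn2r; exact: mulrn_expr_le.
Unshelve. all: by end_near. Qed.

Section TupleSumLimit.
Variables (R : realType) (p : nat) (G : finZmodType) (T : finType) (v : T -> nat).
Variables (eps : R) (u : nat).
Hypothesis p_prime : prime p.
Hypothesis pG : (p.-group [set: G]%G)%g.
Hypothesis eps_gt0 : 0 < eps.
Hypothesis eps_le : eps <= 2^-1.
Hypothesis T_gt0 : (0 < #|T|)%N.

Definition balanced (I J : finType) (q : J -> I -> T -> R) :=
  [/\ forall j i t, 0 <= q j i t, forall j i, \sum_t q j i t = 1 &
      forall j i r, \sum_(t | v t == r %[mod p]) q j i t <= 1 - eps].

(** The sequence [err] is chosen before the laws [q], which may therefore vary freely with [n]. *)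
Lemma tuple_sum_vanishes :
  exists2 err : nat -> R, (err @ \oo --> (0 : R))%classic &
  forall n (q : 'I_(n + u) -> 'I_n -> T -> R), balanced q ->
    \sum_(b : {ffun 'I_n -> G})
      `|tuple_prob v q b - #|tuple_span b|%:R^-1 ^+ (n + u) | <= err n.
Proof.
have G0 : (0 < #|G|)%N by apply/card_gt0P; exists 0.
have [D GD] : exists D, #|G|%:R <= eps / 4 * (1 + eps / 4) ^+ D.
  have y1 : 1 < 1 + eps / 4 by rewrite ltrDl divr_gt0.
  have y0 := lt_trans ltr01 y1.
  have [||D] := @expr_small R (1 + eps / 4)^-1 (eps / 4 / #|G|%:R).
  - by rewrite invr_ge0 ltW //= invf_lt1.
  - by rewrite !divr_gt0 ?ltr0n.
  rewrite exprVn => le; exists D; rewrite -ler_pdivrMr ?exprn_gt0 //.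
  by rewrite mulrC -ler_pdivlMr ?ltr0n.
have eps_le1 : eps <= 1 by move: eps_le; lra.
pose rho := mixing_rate G T eps.
have rho01 : 0 <= rho < 1.
  by rewrite mixing_rate_ge0 //= mixing_rate_lt1.
pose z n := #|G|%:R * rho ^+ (n %/ (D * #|G|) %/ #|G|).
pose s : R := #|{: {group G}}|%:R.
exists (fun n => s * ((1 + z n) ^+ (n + u) - 1) +
   s * (((1 - eps / 2) ^+ n * (1 + z n) ^+ (n + u)) *+ 2)); last first.
  move=> n q [q0 q1 qb].
  have := @tuple_sum_bound R p G T 'I_n 'I_(n + u) v q eps p_prime pG eps_gt0
     eps_le T_gt0 q0 q1 qb _ D GD.
  by rewrite !card_ord; apply; rewrite leq_addr.
have z0 n : 0 <= z n by rewrite mulr_ge0 ?exprn_ge0 //; case/andP: rho01.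
have zc : ((fun n => z n *+ (n + u)) @ \oo --> (0 : R))%classic.
  have -> : (fun n => z n *+ (n + u)) =
      (fun n => #|G|%:R * (rho ^+ (n %/ (D * #|G| * #|G|)) *+ (n + u))).
    by apply/funext => n; rewrite -mulrnAr -divnMA.
  rewrite -[X in (_ --> X)%classic](mulr0 #|G|%:R).
  apply: cvgM; first exact: cvg_cst.
  apply: cvg_mulrn_expr_divn rho01.
  (* [D] is positive, for otherwise [GD] would give [#|G| <= eps / 4 < 1]. *)
  rewrite !muln_gt0 G0 !andbT lt0n; apply: contraTneq GD => ->.
  rewrite expr0 mulr1 -ltNge; apply: lt_le_trans (_ : 1 <= _); last by rewrite ler1n.
  by move: eps_le; lra.
have pc : ((fun n => (1 + z n) ^+ (n + u)) @ \oo --> (1 : R))%classic.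
  (* [z n] decays exponentially, so the bound of [(1 + z n) ^+ (n + u)] by the exponential of
     [z n *+ (n + u)] suffices. *)
  have ec : ((fun n => expR (z n *+ (n + u))) @ \oo --> (1 : R))%classic.
    rewrite -expR0; apply: continuous_cvg zc; exact: continuous_expR.
  apply: (@squeeze_cvgr _ _ _ _ (fun=> 1) _ _ _ _ _ ec); [|exact: cvg_cst]; near=> n.
  rewrite exprn_ege1 ?lerDl //= -mulr_natl expRM_natl.
  by rewrite lerXn2r ?nnegrE ?expR_ge0 ?addr_ge0 // expR_ge1Dx.
have qc : ((fun n => (1 - eps / 2) ^+ n) @ \oo --> (0 : R))%classic.
  by apply: cvg_expr; rewrite ger0_norm; move: eps_gt0 eps_le; lra.
have -> : 0 = s * (1 - 1) + s * ((0 * 1) *+ 2) :> R.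
  by rewrite subrr mul0r mul0rn !mulr0 addr0.
apply: cvgD; apply: cvgM; try exact: cvg_cst.
  by apply: cvgB pc _; exact: cvg_cst.
by apply: cvgMn; apply: cvgM.
Unshelve. all: by end_near. Qed.

End TupleSumLimit.

(** * Lattices of relations *)

Section IntegerRelations.
Variables (B : zmodType) (n e : nat) (b : 'I_n -> B).
Hypothesis e_gt0 : (0 < e)%N.
Hypothesis be0 : forall i, b i *+ e = 0.

Definition int_comb (y : 'cV[int]_n) : B := \sum_i b i *~ y i 0.

Lemma int_combD : {morph int_comb : x y / x + y}.
Proof.
by move=> x y; rewrite -big_split /=; apply: eq_bigr => i _; rewrite mxE mulrzDr.
Qed.

Lemma int_comb0 : int_comb 0 = 0.
Proof. by rewrite /int_comb big1 // => i _; rewrite mxE mulr0z. Qed.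

Lemma int_combZ c y : int_comb (c *: y) = int_comb y *~ c.
Proof.
rewrite /int_comb mulrz_suml; apply: eq_bigr => i _.
by rewrite mxE mulrC mulrzA.
Qed.

Lemma int_combB y z : int_comb (y - z) = int_comb y - int_comb z.
Proof. by apply: (addIr (int_comb z)); rewrite -int_combD !subrK. Qed.

Lemma int_comb_delta i : int_comb (delta_mx i 0) = b i.
Proof.
rewrite /int_comb (bigD1 i) //= big1 ?addr0 => [|j /negPf ji].
  by rewrite mxE !eqxx.
by rewrite mxE ji mulr0z.
Qed.

Lemma int_comb_mul m (M : 'M[int]_(n, m)) (w : 'cV[int]_m) :
  int_comb (M *m w) = \sum_j int_comb (col j M) *~ w j 0.
Proof.
have -> : M *m w = \sum_j w j 0 *: col j M.
  apply/colP => i; rewrite mxE summxE; apply: eq_bigr => j _.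
  by rewrite !mxE mulrC.
rewrite (big_morph _ int_combD int_comb0).
by apply: eq_bigr => j _; rewrite int_combZ.
Qed.

Lemma int_comb_mule (y : 'cV[int]_n) : int_comb (e%:R *: y) = 0.
Proof.
rewrite int_combZ natz -pmulrn -sumrMnl big1 // => i _.
by rewrite pmulrn mulrzAC -pmulrn be0 mul0rz.
Qed.

(* The lattice of relations contains [e Z^n], so the Smith normal form of a    *)
(* matrix of generators yields a square matrix [A] of the same column span.    *)
Lemma int_relations_basis : exists A A' : 'M[int]_n,
  [/\ A *m A' = e%:R%:M, A' *m A = e%:R%:M &
      forall y, int_comb y = 0 <-> exists z, y = A *m z].
Proof.
(* The generators are [e] times the unit vectors and all relations with entries in [0, e); a residue
   vector that is not a relation becomes a zero column. *)
pose k := #|{ffun 'I_n -> 'I_e}|.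
pose x (j : 'I_k) : 'cV[int]_n := \col_i ((enum_val j : {ffun 'I_n -> 'I_e}) i)%:Z.
pose M1 := \matrix_(i < n, j < k) (if int_comb (x j) == 0 then x j i 0 else 0).
pose M : 'M[int]_(n, n + k) := row_mx e%:R%:M M1.
have colM1 j : int_comb (col j M1) = 0.
  have [xj|xj] := eqVneq (int_comb (x j)) 0.
    rewrite -[RHS]xj; congr int_comb; apply/colP => i.
    by rewrite /M1 [LHS]mxE [LHS]mxE xj eqxx.
  rewrite -[RHS]int_comb0; congr int_comb; apply/colP => i.
  by rewrite /M1 [LHS]mxE [LHS]mxE (negPf xj) mxE.
have imM y : int_comb y = 0 <-> exists w, y = M *m w.
  split=> [y0|[w ->]]; last first.
    rewrite -[w]vsubmxK mul_row_col int_combD mul_scalar_mx int_comb_mule add0r.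
    by rewrite int_comb_mul big1 // => j _; rewrite colM1 mul0rz.
  pose a i := modz (y i 0) e.
  pose r : {ffun 'I_n -> 'I_e} := [ffun i => insubd (Ordinal e_gt0) `|a i|%N].
  have rE i : ((r i : nat) : int) = a i.
    have e0 : (e : int) != 0 by rewrite eqz_nat -lt0n.
    have ge0 : 0 <= a i by rewrite /a modz_ge0.
    rewrite ffunE val_insubd.
    have -> : (`|a i| < e)%N.
      by rewrite -ltz_nat gez0_abs // /a ltz_pmod // ltz_nat.
    by rewrite gez0_abs.
  pose z : 'cV[int]_n := \col_i divz (y i 0) e.
  have yE : y = e%:R *: z + x (enum_rank r).
    apply/colP => i; rewrite !mxE enum_rankK rE.
    by rewrite [LHS](divz_eq (y i 0) e) mulrC natz.
  have x0 : int_comb (x (enum_rank r)) = 0.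
    by move: y0; rewrite yE int_combD int_comb_mule add0r.
  exists (col_mx z (delta_mx (enum_rank r) 0)).
  rewrite mul_row_col mul_scalar_mx -colE {1}yE; congr (_ + _).
  by apply/colP => i; rewrite /M1 [RHS]mxE [RHS]mxE x0 eqxx.
have [L Lu [Q Qu [d _ ME]]] := int_Smith_normal_form M.
set D := \matrix_(i, j) _ in ME.
have DE : D = row_mx (diag_mx (\row_(i < n) nth 0 d i)) 0.
  apply/matrixP => i j; rewrite mxE; case: (split_ordP j) => j' ->.
    by rewrite row_mxEl !mxE -val_eqE.
  rewrite row_mxEr mxE; case: eqP => // ij; have := ltn_ord i.
  by rewrite ij ltnNge leq_addr.
pose A := L *m diag_mx (\row_(i < n) nth 0 d i).
have MQ c (w : 'M[int]_(n + k, c)) : M *m w = A *m usubmx (Q *m w).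
  by rewrite ME DE -!mulmxA -[Q *m w in LHS]vsubmxK mul_row_col mul0mx addr0.
have AM z : A *m z = M *m (invmx Q *m col_mx z 0).
  by rewrite MQ mulKVmx // col_mxKu.
clearbody A.
pose A' := usubmx (Q *m col_mx 1%:M 0).
have AA' : A *m A' = e%:R%:M.
  by rewrite -MQ mul_row_col mulmx1 mulmx0 addr0.
have detA : \det A != 0.
  have : \det (A *m A') != 0.
    by rewrite AA' det_scalar expf_neq0 // pnatr_eq0 -lt0n.
  by rewrite det_mulmx mulf_eq0 negb_or => /andP[].
exists A, A'; split=> // [|y].
  (* [A] is invertible over the rationals, so [A *m A'] scalar makes [A] and [A'] commute; the
     adjugate keeps the computation over the integers. *)
  have : \det A *: (A' *m A) = \det A *: e%:R%:M.
    have -> : \det A *: (A' *m A) = \adj A *m (A *m A') *m A.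
      by rewrite !mulmxA mul_adj_mx -mulmxA mul_scalar_mx.
    by rewrite AA' mul_mx_scalar -scalemxAl mul_adj_mx !scale_scalar_mx mulrC.
  move/matrixP => E; apply/matrixP => i j; apply: (mulfI detA).
  by have := E i j; rewrite [LHS]mxE [RHS]mxE.
rewrite imM; split=> [[w ->]|[z ->]]; first by exists (usubmx (Q *m w)); rewrite MQ.
by exists (invmx Q *m col_mx z 0); rewrite AM.
Qed.

End IntegerRelations.

Lemma Zp_intr_eq0 q (c : int) : (1 < q)%N -> (c%:~R == 0 :> 'Z_q) = (q %| c)%Z.
Proof.
move=> q1; have natE m : (m%:R == 0 :> 'Z_q) = (q %| m)%N.
  by rewrite -val_eqE /= val_Zp_nat.
by case: c => m; rewrite ?NegzE ?rmorphN ?oppr_eq0 /= -?pmulrn natE // dvdzE absz_nat.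
Qed.

Lemma Fp_intr_eq0 p (c : int) : prime p -> (c%:~R == 0 :> 'F_p) = (p %| c)%Z.
Proof. by move=> pp; rewrite (dvdz_pcharf (pchar_Fp pp)). Qed.

Definition zlift q m n (M : 'M['Z_q]_(m, n)) : 'M[int]_(m, n) :=
  map_mx (fun x : 'Z_q => (x : nat)%:Z) M.

Notation intr_mx T := (map_mx (intr : int -> T)).

Lemma zliftK q m n (M : 'M['Z_q]_(m, n)) : intr_mx ('Z_q) (zlift M) = M.
Proof. by apply/matrixP => i j; rewrite !mxE -pmulrn natr_Zp. Qed.

Lemma zlift_FpK p m n (M : 'M['F_p]_(m, n)) : intr_mx ('F_p) (zlift M) = M.
Proof. exact: zliftK. Qed.

Section ModPrimePower.
Variables (p N : nat).
Hypothesis p_prime : prime p.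
Local Notation Q := 'Z_(p ^ N.+1).

Lemma expn_gt1 : (1 < p ^ N.+1)%N.
Proof. by rewrite -(exp1n N.+1) ltn_exp2r // prime_gt1. Qed.

(** Multiplication by p^N embeds F_p into Z/p^(N+1); this is how forms modulo [p] are encoded at the
    level p^(N+1). *)
Lemma intr_mx_scaled_eq m n (U V : 'M[int]_(m, n)) :
  intr_mx Q ((p ^ N)%N%:R *: U) = intr_mx Q ((p ^ N)%N%:R *: V) <->
  intr_mx ('F_p) U = intr_mx ('F_p) V.
Proof.
have E i j : ((intr_mx Q ((p ^ N)%N%:R *: U)) i j == (intr_mx Q ((p ^ N)%N%:R *: V)) i j)
     = (intr_mx ('F_p) U i j == intr_mx ('F_p) V i j).
  rewrite !mxE -subr_eq0 -rmorphB -mulrBr /= Zp_intr_eq0 ?expn_gt1 //.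
  rewrite -[RHS]subr_eq0 -rmorphB /= Fp_intr_eq0 // expnS mulnC PoszM natz.
  by rewrite dvdz_mul2l // eqz_nat -lt0n expn_gt0 prime_gt0.
by split=> /matrixP e; apply/matrixP => i j; apply/eqP; move: (e i j) => /eqP;
  rewrite E.
Qed.

Variables (B : finZmodType) (n : nat).
Implicit Types (b : 'I_n -> B) (A : 'M[int]_n).

Definition relation_basis b A A' :=
  [/\ A *m A' = (p ^ N)%N%:R%:M, A' *m A = (p ^ N)%N%:R%:M &
      forall y, int_comb b y = 0 <-> exists z, y = A *m z].

Definition mod_comb b m (a : 'M[Q]_(n, m)) j : B := \sum_i b i *+ a i j.

Lemma mod_combE b m (a : 'M[Q]_(n, m)) j : mod_comb b a j = int_comb b (col j (zlift a)).
Proof. by apply: eq_bigr => i _; rewrite !mxE pmulrn. Qed.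

(* The forms [w] on [F_p^n] give all linear forms modulo [p] on the lattice    *)
(* [A Z^n], namely [x |-> w (A^-1 x)]. As [A^-1 = A' / p^N], such a form       *)
(* vanishes at [x] iff [w A' x = 0 mod p^(N+1)].                               *)
Definition dual_mx (A' : 'M[int]_n) k (W : 'M['F_p]_(k, n)) : 'M[Q]_(k, n) :=
  intr_mx Q (zlift W *m A').

Lemma relation_factor b A A' m (a : 'M[Q]_(n, m)) : relation_basis b A A' ->
  (forall j, mod_comb b a j = 0) -> exists Y, zlift a = A *m Y.
Proof.
move=> [_ _ bA] ba0.
have /choice[f fP] j : exists z, col j (zlift a) = A *m z.
  by apply/bA; rewrite -mod_combE.
exists (\matrix_(i, j) f j i 0); apply/matrixP => i j.
have := congr1 (fun M : 'cV_n => M i 0) (fP j); rewrite [LHS]mxE => ->.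
by rewrite !mxE; apply: eq_bigr => l _; rewrite mxE.
Qed.

(** On [A *m Y] the form [W *m A'] takes the value p^N W Y, since [A' *m A] is p^N. *)
Lemma dual_mx_mul_eq0 b A A' m (a : 'M[Q]_(n, m)) Y k (W : 'M['F_p]_(k, n)) :
  relation_basis b A A' -> zlift a = A *m Y ->
  (dual_mx A' W *m a == 0) = (W *m intr_mx ('F_p) Y == 0).
Proof.
move=> [_ A'A _] aE.
have -> : dual_mx A' W *m a = intr_mx Q ((p ^ N)%N%:R *: (zlift W *m Y)).
  rewrite /dual_mx -{1}[a]zliftK aE -map_mxM /=; congr map_mx.
  by rewrite -mulmxA (mulmxA A') A'A mul_scalar_mx scalemxAr.
have W0 : W *m intr_mx ('F_p) Y = intr_mx ('F_p) (zlift W *m Y).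
  by rewrite map_mxM zlift_FpK.
have := intr_mx_scaled_eq (zlift W *m Y) 0; rewrite scaler0 !map_mx0 -W0 => E.
by apply/eqP/eqP => /E.
Qed.

Lemma dual_mx_inj b A A' k : relation_basis b A A' ->
  injective (@dual_mx A' k).
Proof.
move=> [_ A'A _] W W' /(congr1 (fun M => M *m intr_mx Q A)).
rewrite /dual_mx -!map_mxM /= -!mulmxA A'A !mul_mx_scalar.
by move/intr_mx_scaled_eq; rewrite !zlift_FpK.
Qed.

End ModPrimePower.

HB.instance Definition _ (U V : finZmodType) := GRing.Zmodule.on (U * V)%type.

Lemma mem_tuple_spanP (G : finZmodType) n (c : 'I_n -> G) (x : G) :
  x \in tuple_span c <-> exists y : 'cV[int]_n, x = int_comb c y.
Proof.
pose S : {set G} := [set g | `[< exists y : 'cV[int]_n, g = int_comb c y >]]%SET.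
have gS : group_set S.
  apply/group_setP; split=> [|g h].
    by rewrite inE; apply/asboolP; exists 0; rewrite int_comb0.
  rewrite !inE => /asboolP[y ->] /asboolP[z ->]; apply/asboolP.
  by exists (y + z); rewrite int_combD.
split=> [xc|[y ->]].
  have sub : tuple_span c \subset Group gS.
    apply: gen_sub => i _; rewrite inE; apply/asboolP; exists (delta_mx i 0).
    by rewrite int_comb_delta.
  by have := subsetP sub x xc; rewrite inE => /asboolP.
apply: (big_ind (fun g => g \in tuple_span c)) => [||i _]; first exact: group1.
  by move=> g h; exact: groupM.
have ci : c i \in tuple_span c by apply: gen_mem.
case: (y i 0) => k; first by rewrite -pmulrn -FinRing.zmodXgE groupX.
by rewrite NegzE -nmulrn -FinRing.zmodVgE -FinRing.zmodXgE groupV groupX.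
Qed.

Section ExtendedTuple.
Variables (p N : nat).
Hypothesis p_prime : prime p.
Variables (B : finZmodType) (n k : nat).
Local Notation Q := 'Z_(p ^ N.+1).
Implicit Types (b : 'I_n -> B) (A : 'M[int]_n) (W : 'M['F_p]_(k, n)).

(* Relations of [ext_tuple b A' W] are the relations of [b] killed by the [k]  *)
(* forms that the rows of [W] define on the relation lattice of [b].           *)
Definition ext_tuple b (A' : 'M[int]_n) W : {ffun 'I_n -> B * 'cV[Q]_k} :=
  [ffun i => (b i, col i (dual_mx N A' W))].

Lemma ext_comb b A' W m (a : 'M[Q]_(n, m)) j :
  \sum_i ext_tuple b A' W i *+ a i j =
    (mod_comb b a j, col j (dual_mx N A' W *m a)).
Proof.
apply/eqP; rewrite -pair_eqE /=; apply/andP; split; apply/eqP.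
  by rewrite /mod_comb (raddf_sum fst); apply: eq_bigr => i _; rewrite raddfMn ffunE.
rewrite (raddf_sum snd).
apply/colP => l; rewrite summxE !mxE; apply: eq_bigr => i _.
rewrite raddfMn ffunE -[in RHS](natr_Zp (a i j)) mulr_natr.
by rewrite mulmxnE mxE.
Qed.

Lemma ext_tuple_inj b1 b2 A1 A1' A2' W1 W2 :
  relation_basis p N b1 A1 A1' -> (b1 =1 b2 -> A1' = A2') ->
  ext_tuple b1 A1' W1 = ext_tuple b2 A2' W2 -> b1 =1 b2 /\ W1 = W2.
Proof.
move=> r1 A12 /ffunP e; have e1 : b1 =1 b2.
  by move=> i; have := e i; rewrite !ffunE => -[].
split=> //; rewrite -(A12 e1) in e; apply: (dual_mx_inj p_prime r1).
apply/matrixP => i j; have := e j; rewrite !ffunE => -[_].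
by move/(congr1 (fun M : 'cV_k => M i 0)); rewrite !mxE.
Qed.

Lemma int_comb_ext b A' W y :
  int_comb (ext_tuple b A' W) y =
  (int_comb b y, intr_mx Q (zlift W *m A' *m y)).
Proof.
apply/eqP; rewrite -pair_eqE /=; apply/andP; split; apply/eqP.
  by rewrite /int_comb (raddf_sum fst); apply: eq_bigr => i _; rewrite raddfMz ffunE.
rewrite /int_comb (raddf_sum snd) map_mxM /=.
apply/colP => l; rewrite summxE !mxE; apply: eq_bigr => i _.
by rewrite raddfMz ffunE /= -scaler_int !mxE mulrC.
Qed.

(** The span is an extension of [B] by the values of the [k] forms on the lattice of [b]. These fill
    a copy of F_p^k inside p^N Q^k, because [W] has a right inverse. *)
Lemma card_span_ext_tuple b A A' W : relation_basis p N b A A' ->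
  tuple_span b = [set: B]%G -> row_free W ->
  #|tuple_span (ext_tuple b A' W)| = (#|B| * p ^ k)%N.
Proof.
move=> [AA' A'A bA] bT /row_freeP[V WV].
have /choice[f fP] (beta : B) : exists y, beta = int_comb b y.
  by apply/mem_tuple_spanP; rewrite bT inE.
pose lift t : 'cV[int]_n := zlift (V *m t).
have liftE (t : 'cV['F_p]_k) : intr_mx ('F_p) (zlift W *m lift t) = t.
  by rewrite map_mxM /= !zlift_FpK mulmxA WV mul1mx.
have dualA z : intr_mx Q (zlift W *m A' *m (A *m z)) =
    intr_mx Q ((p ^ N)%N%:R *: (zlift W *m z)).
  by rewrite -!mulmxA (mulmxA A') A'A mul_scalar_mx scalemxAr.
have combA z : int_comb b (A *m z) = 0 by apply/bA; exists z.
pose g (bt : B * 'cV['F_p]_k) :=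
  int_comb (ext_tuple b A' W) (f bt.1 + A *m lift bt.2).
have gE bt : g bt = (bt.1, intr_mx Q (zlift W *m A' *m f bt.1)
    + intr_mx Q ((p ^ N)%N%:R *: (zlift W *m lift bt.2))).
  by rewrite /g int_comb_ext int_combD combA addr0 -fP mulmxDr map_mxD dualA.
have g_inj : injective g.
  move=> [b1 t1] [b2 t2]; rewrite !gE /= => -[-> /addrI].
  by move/(intr_mx_scaled_eq N p_prime); rewrite !liftE => ->.
have -> : #|tuple_span (ext_tuple b A' W)| = #|g @: [set: B * 'cV['F_p]_k]|.
  apply: eq_card => x; apply/idP/imsetP => [/mem_tuple_spanP[y ->]|[bt _ ->]]; last first.
    by apply/mem_tuple_spanP; eexists.
  have /bA[z yz] : int_comb b (y - f (int_comb b y)) = 0.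
    by rewrite -scaleN1r int_combD int_combZ mulrN1z -fP subrr.
  exists (int_comb b y, W *m intr_mx ('F_p) z); rewrite ?inE // gE /=.
  rewrite int_comb_ext; congr (_, _).
  have -> : y = f (int_comb b y) + A *m z by rewrite -yz addrC subrK.
  rewrite int_combD combA addr0 -fP mulmxDr map_mxD dualA; congr (_ + _).
  apply/(intr_mx_scaled_eq N p_prime).
  by rewrite liftE map_mxM /= zlift_FpK.
by rewrite card_imset // cardsT card_prod card_mx muln1 card_Fp.
Qed.

End ExtendedTuple.

(** * Matrices of p-adic integers *)

Section PadicArithmetic.
Variable p : nat.
Hypothesis p_prime : prime p.
Local Notation Zp := (padic_int p).

Definition res k (x : Zp) : 'Z_(p ^ k.+1) := residue x k.

Lemma res_zmod_morphism k : zmod_morphism (res k).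
Proof. by []. Qed.

Lemma res_monoid_morphism k : monoid_morphism (res k).
Proof. by []. Qed.

HB.instance Definition _ k := GRing.isZmodMorphism.Build Zp ('Z_(p ^ k.+1))
  (res k) (res_zmod_morphism k).
HB.instance Definition _ k := GRing.isMonoidMorphism.Build Zp ('Z_(p ^ k.+1))
  (res k) (res_monoid_morphism k).

Lemma residue_natr m k : (m%:R : Zp) k = m%:R.
Proof. exact: (rmorph_nat (res k)). Qed.

Lemma residue_lt (x : Zp) k : (x k < p ^ k.+1)%N.
Proof. by have := ltn_ord (x k); rewrite [X in (_ < X)%N]Zp_cast ?expn_gt1. Qed.

Lemma residue_mod (x : Zp) j k : (j <= k)%N -> x j = (x k %% p ^ j.+1)%N :> nat.
Proof.
move=> /subnK <-; elim: (k - j)%N => [|i IH]; first by rewrite modn_small ?residue_lt.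
rewrite IH addSn -(residueP x (i + j)) /=.
rewrite [X in ((_ %% X) %% _)%N]Zp_cast ?expn_gt1 // modn_dvdm //.
by rewrite dvdn_exp2l // ltnS leq_addl.
Qed.

Lemma natr_residue (x : Zp) k : ((x k : nat)%:R : Zp) k = x k.
Proof. by rewrite residue_natr natr_Zp. Qed.

(** Dividing by p^(N+1) loses [N.+1] digits, so the residue of level [k] is read off [x] at level
    [k + N.+1]. *)
Fact divp_subproof (x : Zp) N k :
  Zp_red (inZp (x (k.+1 + N.+1)%N %/ p ^ N.+1) : 'Z_(p ^ k.+2))
  = inZp (x (k + N.+1)%N %/ p ^ N.+1) :> 'Z_(p ^ k.+1).
Proof.
have kN : (k + N.+1 <= k.+1 + N.+1)%N by rewrite leq_add2r.
have := residue_mod x kN; set a := nat_of_ord (x (k.+1 + N.+1)%N).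
set c := nat_of_ord (x (k + N.+1)%N); clearbody a c => ->.
apply: val_inj; rewrite /= !Zp_cast ?expn_gt1 // modn_dvdm ?dvdn_exp2l //.
by rewrite -addSn expnD -modn_divl modn_mod.
Qed.

Lemma padic_dvdP (x : Zp) N : x N = 0 -> exists y, x = (p ^ N.+1)%N%:R * y.
Proof.
move=> xN; exists (PadicInt (divp_subproof x N)); apply: padic_intP => k.
rewrite /= residue_natr.
have -> : inZp (x (k + N.+1)%N %/ p ^ N.+1)
    = (x (k + N.+1)%N %/ p ^ N.+1)%N%:R :> 'Z_(p ^ k.+1).
  by rewrite Zp_nat.
rewrite -natrM mulnC divnK; last first.
  rewrite /dvdn -residue_mod ?xN //.
  by rewrite addnS ltnW // ltnS leq_addl.
apply: val_inj; rewrite /= val_Zp_nat ?expn_gt1 //.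
by apply: residue_mod; rewrite leq_addr.
Qed.

Lemma padic_split (x : Zp) N : exists y, x = (x N : nat)%:R + (p ^ N.+1)%N%:R * y.
Proof.
have [|y e] := @padic_dvdP (x - (x N : nat)%:R) N.
  by rewrite /= natr_residue subrr.
by exists y; rewrite -e addrC subrK.
Qed.

Lemma padic_inv (x : Zp) : x 0%N != 0 -> exists y, x * y = 1.
Proof.
move=> x0.
have unit_x k : x k \is a GRing.unit.
  rewrite -(natr_Zp (x k)) unitZpE ?expn_gt1 // coprimeXl //.
  rewrite prime_coprime //; apply: contra x0 => pxk.
  apply/eqP; apply: val_inj; apply: etrans (residue_mod x (leq0n k)) _.
  by rewrite expn1; exact/eqP.
have inv_red k : Zp_red (x k.+1)^-1 = (x k)^-1.
  apply: (mulrI (unit_x k)); rewrite divrr; last exact: unit_x.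
  by rewrite -{1}(residueP x k) -Zp_redM divrr ?Zp_red1; last exact: unit_x.
by exists (PadicInt inv_red); apply: padic_intP => k /=; apply: divrr; exact: unit_x.
Qed.

(** The determinant is 1 modulo [p], hence a unit, and the adjugate provides the inverse. This plays
    the part of Nakayama's lemma. *)
Lemma padic_unit_mx n (T : 'M[Zp]_n) : exists U, (1%:M + p%:R *: T) *m U = 1%:M.
Proof.
set M := 1%:M + _.
have [|y My] := @padic_inv (\det M).
  rewrite -[X in X != _]/(res 0 _) -det_map_mx map_mxD map_mx1 map_mxZ rmorph_nat.
  have -> : p%:R = 0 :> 'Z_(p ^ 1) by apply: (pchar_Zp (prime_gt1 p_prime)).
  by rewrite scale0r addr0 det1 oner_eq0.
exists (y *: \adj M); rewrite -scalemxAr mul_mx_adj scale_scalar_mx mulrC My //.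
Qed.

End PadicArithmetic.

Lemma mulrn_Zp_intr (V : zmodType) q (x : V) (c : int) : (1 < q)%N -> x *+ q = 0 ->
  x *+ (c%:~R : 'Z_q) = x *~ c.
Proof.
move=> q1 xq; set m := nat_of_ord _.
have : (q %| c - m%:Z)%Z.
  by rewrite -Zp_intr_eq0 // rmorphB /= -pmulrn natr_Zp subrr.
case/dvdzP => d /eqP; rewrite subr_eq => /eqP ->.
by rewrite mulrzDr mulrC mulrzA -pmulrn xq mul0rz add0r pmulrn.
Qed.

Lemma intr_Fp_eq_split p m n (U V : 'M[int]_(m, n)) : prime p ->
  intr_mx ('F_p) U = intr_mx ('F_p) V -> exists S, U = V + p%:R *: S.
Proof.
move=> pp /matrixP e; exists (\matrix_(i, j) divz (U i j - V i j) p).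
apply/matrixP => i j; have dvd : (p %| U i j - V i j)%Z.
  rewrite -(Fp_intr_eq0 _ pp) rmorphB /= subr_eq0.
  by have := e i j; rewrite !mxE => ->.
by rewrite !mxE natz [_ * divz _ _]mulrC divzK // addrC subrK.
Qed.

Section PadicKernel.
Variables (p N : nat).
Hypothesis p_prime : prime p.
Local Notation Zp := (padic_int p).
Local Notation Q := 'Z_(p ^ N.+1).

Definition res_mx m n (X : 'M[Zp]_(m, n)) : 'M[Q]_(m, n) := map_mx (res N) X.

Lemma res_mx_intr m n (M : 'M[int]_(m, n)) : res_mx (intr_mx Zp M) = intr_mx Q M.
Proof. by apply/matrixP => i j; rewrite !mxE rmorph_int. Qed.

Lemma padic_mx_split m n (X : 'M[Zp]_(m, n)) :
  exists Z, X = intr_mx Zp (zlift (res_mx X)) + (p ^ N.+1)%N%:R *: Z.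
Proof.
have /choice[f fP] (ij : 'I_m * 'I_n) : exists y,
   X ij.1 ij.2 = (X ij.1 ij.2 N : nat)%:R + (p ^ N.+1)%N%:R * y by exact: padic_split.
exists (\matrix_(i, j) f (i, j)); apply/matrixP => i j.
by rewrite !mxE -pmulrn -(fP (i, j)).
Qed.

Lemma res_mxD m n : {morph @res_mx m n : X Y / X + Y}.
Proof. by move=> X Y; rewrite /res_mx map_mxD. Qed.

Lemma res_mx_pexp m n (Z : 'M[Zp]_(m, n)) : res_mx ((p ^ N.+1)%N%:R *: Z) = 0.
Proof.
by rewrite /res_mx map_mxZ rmorph_nat pchar_Zp ?expn_gt1 // scale0r.
Qed.

Variables (B : finZmodType) (n : nat) (b : 'I_n -> B) (A A' : 'M[int]_n).
Hypothesis B_exp : forall x : B, x *+ (p ^ N) = 0.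
Hypothesis bA : relation_basis p N b A A'.

(** The homomorphism Z_p^n -> B attached to [b]; as p^N kills [B], it may be computed on residues
    modulo p^(N+1). *)
Definition padic_comb (x : 'cV[Zp]_n) : B := mod_comb b (res_mx x) 0.

Lemma mod_comb_intr m (M : 'M[int]_(n, m)) j :
  mod_comb b (intr_mx Q M) j = int_comb b (col j M).
Proof.
apply: eq_bigr => i _; rewrite !mxE mulrn_Zp_intr ?expn_gt1 //.
by rewrite expnS mulnC mulrnA B_exp mul0rn.
Qed.

(** The integral basis of relations is also a p-adic one: [x] differs from an integer vector by an
    element of p^(N+1) Z_p^n, and p^(N+1) = p A A'. *)
Lemma padic_combP x : padic_comb x = 0 <-> exists z, x = intr_mx Zp A *m z.
Proof.
have [AA' A'A kerA] := bA; split=> [x0|[z ->]].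
  have [Z xE] := padic_mx_split x.
  have /kerA[z0 z0E] : int_comb b (zlift (res_mx x)) = 0.
    move: x0; rewrite /padic_comb mod_combE => <-; congr int_comb.
    by apply/colP => i; rewrite [RHS]mxE.
  exists (intr_mx Zp z0 + p%:R *: (intr_mx Zp A' *m Z)).
  rewrite mulmxDr -map_mxM /= -z0E -scalemxAr mulmxA -map_mxM /= AA'.
  rewrite map_scalar_mx /= mul_scalar_mx scalerA rmorph_nat -natrM -expnS.
  exact: xE.
have [Z ->] := padic_mx_split z.
rewrite /padic_comb mulmxDr -scalemxAr res_mxD.
rewrite res_mx_pexp addr0 -map_mxM /= res_mx_intr mod_comb_intr.
by apply/kerA; exists (zlift (res_mx z)); apply/colP => i; rewrite mxE.
Qed.

(** Once [b] kills [X], one has X = A Y', and the image is the whole lattice iff [Y'] is onto. By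
    Nakayama this is onto modulo [p], that is, no nonzero form kills [Y'] modulo [p]. Both resulting
    conditions involve [X] modulo p^(N+1) only. *)
Lemma padic_kernel_eq_image m (X : 'M[Zp]_(n, m)) :
  (forall x, padic_comb x = 0 <-> exists v, x = X *m v) <->
  (forall j, mod_comb b (res_mx X) j = 0) /\
  (forall W : 'M['F_p]_(1, n), dual_mx N A' W *m res_mx X = 0 -> W = 0).
Proof.
have [AA' A'A kerA] := bA; split=> [kerX|[ba0 W0]].
  split=> [j|W WX].
    have <- : padic_comb (col j X) = mod_comb b (res_mx X) j.
      by apply: eq_bigr => i _; rewrite !mxE.
    by apply/kerX; exists (delta_mx j 0); rewrite -colE.
  have /choice[f fP] j : exists v, col j (intr_mx Zp A) = X *m v.
    by apply/kerX/padic_combP; exists (delta_mx j 0); rewrite -colE.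
  have AE : intr_mx Zp A = X *m (\matrix_(i, j) f j i 0).
    apply/matrixP => i j; have := congr1 (fun M : 'cV_n => M i 0) (fP j).
    rewrite [LHS]mxE => ->.
    by rewrite !mxE; apply: eq_bigr => l _; rewrite mxE.
  have : dual_mx N A' W *m intr_mx Q A = 0.
    by rewrite -res_mx_intr AE /res_mx map_mxM mulmxA WX mul0mx.
  rewrite /dual_mx -map_mxM /= -mulmxA A'A mul_mx_scalar => pW.
  rewrite -[LHS]zlift_FpK -[RHS](map_mx0 (intr : int -> 'F_p)).
  by apply/(intr_mx_scaled_eq N p_prime); rewrite pW scaler0 map_mx0.
have [Y aY] := relation_factor bA ba0.
have /row_freeP[V YV] : row_free (intr_mx ('F_p) Y).
  apply: inj_row_free => W WY; apply: W0; apply/eqP.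
  by rewrite (dual_mx_mul_eq0 p_prime _ bA aY) WY.
have [Z XE] := padic_mx_split X.
(* The remainder p^(N+1) Z equals A (p A' Z), so [X] itself factors through [A], with a cofactor
   congruent to [Y] modulo [p]. *)
pose Y' := intr_mx Zp Y + p%:R *: (intr_mx Zp A' *m Z).
have {}XE : X = intr_mx Zp A *m Y'.
  rewrite mulmxDr -map_mxM /= -aY -scalemxAr mulmxA -map_mxM /= AA'.
  rewrite map_scalar_mx /= mul_scalar_mx scalerA rmorph_nat -natrM -expnS.
  exact: XE.
have [S YS] : exists S, Y *m zlift V = 1%:M + p%:R *: S.
  apply: intr_Fp_eq_split => //.
  by rewrite map_mxM /= zlift_FpK YV map_mx1.
have [U YU] : exists U, Y' *m intr_mx Zp (zlift V) *m U = 1%:M.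
  have -> : Y' *m intr_mx Zp (zlift V) =
      1%:M + p%:R *: (intr_mx Zp S + intr_mx Zp A' *m Z *m intr_mx Zp (zlift V)).
    rewrite mulmxDl -map_mxM /= YS map_mxD map_mx1 map_mxZ rmorph_nat.
    by rewrite scalerDr addrA -scalemxAl.
  exact: padic_unit_mx.
move=> x; split=> [/padic_combP[z ->]|[v ->]]; last first.
  by apply/padic_combP; exists (Y' *m v); rewrite XE mulmxA.
exists (intr_mx Zp (zlift V) *m U *m z).
by rewrite XE -[z in LHS]mul1mx -YU !mulmxA.
Qed.

End PadicKernel.

(** * Presentations of a finite group as a cokernel *)

Section Presentations.
Variables (p N : nat).
Hypothesis p_prime : prime p.
Local Notation Zp := (padic_int p).
Variables (B : finZmodType) (n : nat).
Hypothesis B_exp : forall x : B, x *+ (p ^ N) = 0.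
Implicit Types (b : 'I_n -> B).

Lemma mulrn_expS (x : B) : x *+ (p ^ N.+1) = 0.
Proof. by rewrite expnS mulnC mulrnA B_exp mul0rn. Qed.

Lemma padic_comb_intr b (y : 'cV[int]_n) :
  padic_comb N b (intr_mx Zp y) = int_comb b y.
Proof.
rewrite /padic_comb res_mx_intr mod_comb_intr //.
by congr int_comb; apply/colP => i; rewrite mxE.
Qed.

Lemma padic_comb_pexp b (Z : 'cV[Zp]_n) : padic_comb N b ((p ^ N.+1)%N%:R *: Z) = 0.
Proof.
by rewrite /padic_comb res_mx_pexp // /mod_comb big1 // => i _; rewrite mxE mulr0n.
Qed.

Lemma padic_combD b : {morph (padic_comb N b : 'cV[Zp]_n -> B) : x y / x + y}.
Proof.
move=> x y; rewrite /padic_comb res_mxD /mod_comb -big_split /=.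
apply: eq_bigr => i _; rewrite mxE.
set s := res_mx N x i 0; set t := res_mx N y i 0.
have -> : s + t = ((s : nat)%:Z + (t : nat)%:Z)%:~R.
  by rewrite rmorphD /= -!pmulrn !natr_Zp.
by rewrite mulrn_Zp_intr ?expn_gt1 ?mulrn_expS // mulrzDr -!pmulrn.
Qed.

Lemma padic_combB b (x y : 'cV[Zp]_n) :
  padic_comb N b (x - y) = padic_comb N b x - padic_comb N b y.
Proof.
by apply: (addIr (padic_comb N b y)); rewrite -padic_combD !subrK.
Qed.

(** An additive map to [B] kills p^(N+1) Z_p^n, so it is determined by its values on integer
    vectors; no continuity or Z_p-linearity has to be assumed. *)
Lemma additive_padic_comb (g : {additive 'cV[Zp]_n -> B}) x :
  g x = padic_comb N (fun i => g (delta_mx i 0)) x.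
Proof.
have [Z ->] := padic_mx_split N p_prime x.
rewrite padic_combD padic_comb_pexp addr0 padic_comb_intr raddfD.
rewrite scaler_nat raddfMn mulrn_expS addr0.
rewrite /int_comb; set y := zlift _.
have -> : intr_mx Zp y = \sum_i delta_mx i 0 *~ y i 0.
  apply/colP => i; rewrite mxE summxE (bigD1 i) //= big1 ?addr0 => [|j ji].
    by rewrite -scaler_int !mxE !eqxx mulr1.
  by rewrite -scaler_int !mxE eq_sym (negPf ji) mulr0.
by rewrite raddf_sum; apply: eq_bigr => i _; rewrite raddfMz.
Qed.

Definition presents m (X : 'M[Zp]_(n, m)) b :=
  tuple_span b = [set: B]%G /\
  forall x, padic_comb N b x = 0 <-> exists v, x = X *m v.

Lemma presents_iso m (X : 'M[Zp]_(n, m)) b :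
  presents X b -> additively_isomorphic (cok X) B.
Proof.
move=> [spanb kerb].
pose pi (x : 'cV[Zp]_n) : cok X := \pi_(cok X)%qT x.
have piK q : pi (generic_quotient.repr q) = q by exact: reprK.
have piB x y : pi (x - y) = pi x - pi y by exact: raddfB.
pose f (q : cok X) : B := padic_comb N b (generic_quotient.repr q).
have eq_pi x y : (pi x == pi y) = (padic_comb N b x == padic_comb N b y).
  rewrite -Quotient.idealrBE -[RHS]subr_eq0 -padic_combB.
  by apply/asboolP/eqP => /kerb.
have f_pi x : f (pi x) = padic_comb N b x.
  by apply/eqP; rewrite -eq_pi piK.
have fD : zmod_morphism f.
  move=> q r; rewrite -[q]piK -[r]piK -piB !f_pi.
  exact: padic_combB.
pose fA : {additive cok X -> B} := HB.pack f (GRing.isZmodMorphism.Build _ _ f fD).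
have f_inj : injective f.
  move=> q r; rewrite -[q]piK -[r]piK !f_pi => /eqP.
  by rewrite -eq_pi => /eqP.
have /choice[g gP] (beta : B) : exists q, f q = beta.
  have : beta \in tuple_span b by rewrite spanb inE.
  case/mem_tuple_spanP => y ->; exists (pi (intr_mx Zp y)).
  by rewrite f_pi padic_comb_intr.
by exists fA, g => [q|//]; apply: f_inj; rewrite gP.
Qed.

Lemma iso_presents m (X : 'M[Zp]_(n, m)) :
  additively_isomorphic (cok X) B -> exists b, presents X b.
Proof.
move=> [f [g fK gK]].
pose pi (x : 'cV[Zp]_n) : cok X := \pi_(cok X)%qT x.
have piB x y : pi (x - y) = pi x - pi y by exact: raddfB.
pose h (x : 'cV[Zp]_n) : B := f (pi x).
have hD : zmod_morphism h.
  by move=> x y; rewrite /h piB raddfB.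
pose hA : {additive 'cV[Zp]_n -> B} := HB.pack h (GRing.isZmodMorphism.Build _ _ h hD).
have hE := additive_padic_comb hA.
exists (fun i => hA (delta_mx i 0)); split=> [|x].
  apply/val_inj/eqP; rewrite eqEsubset subsetT /=; apply/subsetP => beta _.
  apply/mem_tuple_spanP; have := hE (generic_quotient.repr (g beta)).
  have [Z zE] := padic_mx_split N p_prime (generic_quotient.repr (g beta)).
  rewrite {2}zE padic_combD padic_comb_pexp addr0 padic_comb_intr /= /h /pi reprK gK => ->.
  by eexists.
have pi0 y : (pi y == pi 0) = (y \in mx_image X).
  by rewrite -[in RHS](subr0 y) Quotient.idealrBE.
rewrite -hE /= /h; split=> [fx0|xX].
  have : x \in mx_image X; last by move/asboolP.
  rewrite -pi0; apply/eqP; apply: (can_inj fK).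
  by rewrite fx0 /pi !raddf0.
have /eqP -> : pi x == pi 0 by rewrite pi0; apply/asboolP.
by rewrite /pi !raddf0.
Qed.

End Presentations.

Section CountPresentations.
Variables (p N : nat).
Hypothesis p_prime : prime p.
Local Notation Zp := (padic_int p).
Variables (B : finZmodType) (n : nat).
Hypothesis B_exp : forall x : B, x *+ (p ^ N) = 0.

Lemma presents_ker m (X : 'M[Zp]_(n, m)) (b1 b2 : 'I_n -> B) y :
  presents N X b1 -> presents N X b2 -> int_comb b1 y = 0 -> int_comb b2 y = 0.
Proof.
move=> [_ k1] [_ k2]; rewrite -!(padic_comb_intr p_prime B_exp).
by move/k1/k2.
Qed.

Lemma Aut_morphD (a : {perm B}) : a \in Aut [set: B]%G -> {morph a : x y / x + y}.
Proof.
rewrite inE => /andP[_ /morphicP aM] x y.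
by rewrite -!FinRing.zmodMgE aM ?inE.
Qed.

Lemma Aut_int_comb (a : {perm B}) (b : 'I_n -> B) y : a \in Aut [set: B]%G ->
  int_comb (fun i => a (b i)) y = a (int_comb b y).
Proof.
move=> /Aut_morphD aD; have aB : zmod_morphism a.
  by move=> x z; apply: (addIr (a z)); rewrite -aD !subrK.
pose aA : {additive B -> B} :=
  HB.pack (a : B -> B) (GRing.isZmodMorphism.Build _ _ (a : B -> B) aB).
rewrite /int_comb -[a _]/(aA _) raddf_sum.
by apply: eq_bigr => i _; rewrite raddfMz.
Qed.

(** The automorphisms of [B] act simply transitively on the surjections onto [B] with a given
    kernel. *)
Lemma card_presents m (X : 'M[Zp]_(n, m)) :
  #|[set b : {ffun 'I_n -> B} | `[< presents N X (b : 'I_n -> B) >]]%SET| =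
  if `[< additively_isomorphic (cok X) B >] then #|Aut [set: B]%G| else 0%N.
Proof.
case: asboolP => [/(iso_presents p_prime B_exp)[b0 pb0]|nIso]; last first.
  apply/eqP; rewrite cards_eq0; apply/set0Pn => -[b]; rewrite inE => /asboolP.
  by move/(presents_iso p_prime B_exp).
have [span0 ker0] := pb0.
pose phi (a : {perm B}) : {ffun 'I_n -> B} := [ffun i => a (b0 i)].
have phiE a y : a \in Aut [set: B]%G -> int_comb (phi a) y = a (int_comb b0 y).
  move=> aA; rewrite -(Aut_int_comb _ _ aA); apply: eq_bigr => i _.
  by rewrite ffunE.
have gen0 beta : exists y, beta = int_comb b0 y.
  by apply/mem_tuple_spanP; rewrite span0 inE.
have phi_inj : {in Aut [set: B]%G &, injective phi}.
  move=> a1 a2 A1 A2 e; apply/permP => x; have [y ->] := gen0 x.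
  by rewrite -!phiE // e.
rewrite -(card_in_imset phi_inj); apply: eq_card => b.
rewrite inE; apply/asboolP/imsetP => [pb|[a aA ->]]; last first.
  have a0 : a 0 = 0 by apply: (addrI (a 0)); rewrite -Aut_morphD // !addr0.
  have combE (x : 'cV[Zp]_n) : padic_comb N (phi a) x = a (padic_comb N b0 x).
    have [Z ->] := padic_mx_split N p_prime x.
    by rewrite !padic_combD // !padic_comb_pexp // !addr0 !padic_comb_intr // phiE.
  split=> [|x].
    apply/val_inj/eqP; rewrite eqEsubset subsetT /=; apply/subsetP => beta _.
    have [y yE] := gen0 (a^-1%g beta); apply/mem_tuple_spanP.
    by exists y; rewrite phiE // -yE permKV.
  rewrite -ker0 combE; split=> [|->//]; rewrite -[in X in X -> _]a0.
  exact: perm_inj.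
have [spanb kerb] := pb.
have /choice[f fP] := gen0.
(* The automorphism carrying [b0] to [b]; it does not depend on the chosen preimages [f], since both
   tuples have the same relations. *)
pose g beta := int_comb b (f beta).
have gE y : g (int_comb b0 y) = int_comb b y.
  apply/eqP; rewrite -subr_eq0 -int_combB; apply/eqP.
  by apply: (presents_ker pb0 pb); rewrite int_combB -fP subrr.
have g_inj : injective g.
  move=> x1 x2 e; apply/eqP; rewrite [x1]fP [x2]fP -subr_eq0 -int_combB; apply/eqP.
  apply: (presents_ker pb pb0); rewrite int_combB.
  by apply/eqP; rewrite subr_eq0; apply/eqP.
exists (perm g_inj).
  rewrite inE; apply/andP; split; first by apply/subsetP => x _; rewrite inE.
  apply/morphicP => x1 x2 _ _; rewrite !permE.
  have [y1 ->] := gen0 x1; have [y2 ->] := gen0 x2.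
  by rewrite !FinRing.zmodMgE -int_combD !gE int_combD.
by apply/ffunP => i; rewrite ffunE permE -[in RHS](int_comb_delta b0) gE int_comb_delta.
Qed.

End CountPresentations.

(** * A q-analogue of the Bonferroni inequalities *)

Section QBonferroni.
Variables (R : realType) (q : R).
Hypothesis q_gt1 : 1 < q.

(* The number of injective linear maps from [F_q^k] to [F_q^r]. *)
Definition inj_count (r k : nat) : R := \prod_(i < k) (q ^+ r - q ^+ i).
Definition qfact (k : nat) : R := \prod_(i < k) (q ^+ i.+1 - 1).

Lemma qfact_gt0 k : 0 < qfact k.
Proof. by apply: prodr_gt0 => i _; rewrite subr_gt0 exprn_egt1. Qed.

Lemma qfactS k : qfact k.+1 = qfact k * (q ^+ k.+1 - 1).
Proof. by rewrite /qfact big_ord_recr. Qed.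

Lemma inj_count_eq0 r k : (r < k)%N -> inj_count r k = 0.
Proof. by move=> rk; rewrite /inj_count (bigD1 (Ordinal rk)) //= subrr mul0r. Qed.

(** As |GL_k(F_q)| is q^(k(k-1)/2) times [qfact k], for [f = inj_count r] this is the Möbius sum
    over the subspaces of F_q^r of dimension at most [M]. *)
Definition bonferroni (f : nat -> R) M : R := \sum_(k < M.+1) (-1) ^+ k * (f k / qfact k).

Lemma bonferroniS f M : bonferroni f M.+1 =
  bonferroni f M + (-1) ^+ M.+1 * (f M.+1 / qfact M.+1).
Proof. exact: big_ord_recr. Qed.

Lemma cvg_bonferroni (f : nat -> nat -> R) (g : nat -> R) M :
  (forall k, ((fun n => f n k) @ \oo --> g k)%classic) ->
  ((fun n => bonferroni (f n) M) @ \oo --> bonferroni g M)%classic.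
Proof.
move=> fg; have term k : ((fun n => (-1) ^+ k * (f n k / qfact k)) @ \oo -->
    (-1) ^+ k * (g k / qfact k))%classic.
  apply: cvgM; first exact: cvg_cst.
  by apply: cvgM (fg k) _; exact: cvg_cst.
elim: M => [|M IH].
  rewrite /bonferroni big_ord1; under eq_fun do rewrite big_ord1; exact: term.
rewrite bonferroniS; under eq_fun do rewrite bonferroniS.
by apply: cvgD.
Qed.

Lemma inj_countS r k :
  inj_count r k.+1 = (q ^+ r - 1) * \prod_(i < k) (q ^+ r - q ^+ i.+1).
Proof. by rewrite /inj_count big_ord_recl expr0. Qed.

Lemma bonferroni_inj_count r M : bonferroni (inj_count r) M =
  (-1) ^+ M * (\prod_(i < M) (q ^+ r - q ^+ i.+1) / qfact M).
Proof.
elim: M => [|M IH].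
  by rewrite /bonferroni big_ord1 /inj_count !big_ord0 /qfact !big_ord0.
rewrite bonferroniS IH.
have c0 := qfact_gt0 M; have d0 : 0 < q ^+ M.+1 - 1 by rewrite subr_gt0 exprn_egt1.
rewrite inj_countS big_ord_recr qfactS [(-1) ^+ M.+1]exprS /=.
set P := \prod_(_ < _) _; set t := q ^+ r; set s := q ^+ M.+1 in d0 *.
by field; rewrite !gt_eqF.
Qed.

(** By the closed form above, the truncated sum is exactly 1 for r = 0 and exactly 0 for 0 < r <= M;
    for larger [r] its size is compared with the next term. *)
Lemma bonferroni_bound r M :
  `|(r == 0)%:R - bonferroni (inj_count r) M| <= inj_count r M.+1 / qfact M.+1.
Proof.
have c0 := qfact_gt0 M; have d0 : 0 < q ^+ M.+1 - 1 by rewrite subr_gt0 exprn_egt1.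
have [->|r0] := posnP r.
  rewrite inj_count_eq0 // mul0r bonferroni_inj_count expr0.
  have -> : \prod_(i < M) (1 - q ^+ i.+1) = (-1) ^+ M * qfact M.
    rewrite /qfact -[M in (-1) ^+ M]card_ord -prodr_const -big_split /=.
    by apply: eq_bigr => i _; rewrite mulN1r opprB.
  by rewrite -mulrA divff ?gt_eqF // mulr1 -expr2 sqrr_sign subrr normr0.
rewrite sub0r normrN bonferroni_inj_count normrM normr_sign mul1r.
have [rM|Mr] := leqP r M.
  have rM' : (r.-1 < M)%N by rewrite prednK.
  rewrite inj_count_eq0 // mul0r (bigD1 (Ordinal rM')) //= prednK //.
  by rewrite subrr !mul0r normr0.
have P0 : 0 <= \prod_(i < M) (q ^+ r - q ^+ i.+1).
  apply: prodr_ge0 => i _; rewrite subr_ge0 ler_weXn2l ?ltW //.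
  by rewrite (leq_trans (ltn_ord i)) // ltnW.
rewrite ger0_norm; last by rewrite divr_ge0 // ltW.
rewrite inj_countS qfactS [_ * (_ - 1)]mulrC -mulf_div.
apply: ler_peMl; first by rewrite divr_ge0 // ltW.
by rewrite ler_pdivlMr // mul1r lerD2r ler_weXn2l // ltW.
Qed.

End QBonferroni.

Section CountRowFree.
Variables (F : finFieldType) (n m : nat) (Y : 'M[F]_(n, m)).

Lemma row_free_col_mx k (w : 'rV[F]_n) (W : 'M[F]_(k, n)) :
  row_free (col_mx w W) = row_free W && ~~ (w <= W)%MS.
Proof.
apply/idP/andP => [fr|[fW wW]]; last first.
  have lt : (W < w + W)%MS by rewrite ltmxE addsmxSr addsmx_sub submx_refl andbT.
  rewrite /row_free eqn_leq rank_leq_row /= -addsmxE add1n.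
  by have := rank_ltmx lt; rewrite (eqP fW).
have rk : \rank (w + W)%MS = k.+1 by rewrite addsmxE; exact/eqP.
split.
  rewrite /row_free eqn_leq rank_leq_row /= -ltnS -rk.
  apply: leq_trans (mxrank_adds_leqif w W) _.
  exact: (leq_add (rank_leq_row w) (leqnn _)).
apply/negP => wW; have := rank_leq_row W.
by rewrite -(addsmx_idPr wW) rk ltnn.
Qed.

Lemma card_submx k (W : 'M[F]_(k, n)) :
  #|[set w : 'rV[F]_n | (w <= W)%MS]%SET| = (#|F| ^ \rank W)%N.
Proof. exact: card_rowg. Qed.

(** A further row must lie in the left kernel of [Y] and outside the row space of [W], which leaves
    q^r - q^k choices. *)
Lemma card_row_free (R : realType) k :
  #|[set W : 'M[F]_(k, n) | row_free W & W *m Y == 0]%SET|%:R =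
  inj_count (#|F|%:R : R) (\rank (kermx Y)) k.
Proof.
elim: k => [|k IH].
  rewrite /inj_count big_ord0 (_ : #|_| = 1%N) //; apply/eqP/cards1P; exists 0.
  apply/setP => W; rewrite !inE [W]flatmx0 mul0mx eqxx andbT.
  by rewrite /row_free mxrank0 !eqxx.
rewrite /inj_count big_ord_recr /= -/(inj_count _ _ _) -IH.
rewrite -[in LHS]sum1_card [LHS]natr_sum; set S := [set W | _]%SET.
rewrite (reindex (fun P : 'M[F]_(k, n) * 'rV[F]_n =>
  col_mx P.2 P.1 : 'M[F]_(k.+1, n))) /=; last first.
  exists (fun V : 'M[F]_(1 + k, n) => (dsubmx V, usubmx V)) => [[W w] _|V _] /=.
    by rewrite col_mxKd col_mxKu.
  by rewrite vsubmxK.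
transitivity (\sum_(W : 'M[F]_(k, n))
    \sum_(w : 'rV[F]_n | (col_mx w W : 'M[F]_(1 + k, n)) \in S) (1 : R)).
  by rewrite pair_big_dep.
rewrite mulr_natl -sumr_const [RHS]big_mkcond; apply: eq_bigr => W _.
have memS (w : 'rV[F]_n) : ((col_mx w W : 'M[F]_(1 + k, n)) \in S)
    = [&& row_free W, W *m Y == 0, w *m Y == 0 & ~~ (w <= W)%MS].
  have -> : (col_mx w W \in S) = row_free (col_mx w W) && (col_mx w W *m Y == 0).
    by rewrite inE.
  rewrite row_free_col_mx mul_col_mx col_mx_eq0.
  by case: (row_free W); case: (w <= W)%MS; case: (w *m Y == 0); rewrite ?andbF ?andbT.
under eq_bigl do rewrite memS.
rewrite inE; have [/andP[fW WY]|WN] := ifPn; last first.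
  by rewrite big1 // => w /and4P[fW WY _ _]; rewrite fW WY in WN.
rewrite fW WY /= -natrX -{2}(eqP fW) -card_submx -!natrX -card_submx.
rewrite sumr_const -natrB; last first.
  apply: subset_leq_card; apply/subsetP => w; rewrite !inE => /submx_trans; apply.
  by apply/sub_kermxP/eqP.
congr (_%:R); rewrite -cardsDS; last first.
  apply/subsetP => w; rewrite !inE => /submx_trans; apply.
  by apply/sub_kermxP/eqP.
apply: eq_card => w; rewrite !inE andbC; congr (_ && _).
by apply/eqP/sub_kermxP.
Qed.

End CountRowFree.

(** * Euler's product *)

Section EulerProduct.
Variables (R : realType) (p : nat).
Hypothesis p_gt1 : (1 < p)%N.
Local Notation q := (p%:R : R).
Local Notation euler x M := (bonferroni q (GRing.exp x) M).

Let q_gt1 : 1 < q. Proof. by rewrite ltr1n. Qed.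
Let q_gt0 : 0 < q. Proof. exact: lt_trans ltr01 q_gt1. Qed.

Lemma qfact_ge1 M : 1 <= qfact q M.
Proof.
elim: M => [|M IH]; first by rewrite /qfact big_ord0.
rewrite qfactS mulr_ege1 // lerBrDr -natrX -[leLHS]/(2%:R) ler_nat.
by rewrite expnS (@leq_mul 2 1) // expn_gt0 ltnW.
Qed.

Lemma qfact_ge M : M%:R <= qfact q M.
Proof.
case: M => [|M]; first by rewrite (le_trans ler01) // qfact_ge1.
rewrite qfactS; apply: (@le_trans _ _ (q ^+ M.+1 - 1)); last first.
  by rewrite ler_peMl ?qfact_ge1 // subr_ge0 exprn_ege1 // ltW.
by rewrite lerBrDr -natrX natr1 ler_nat ltn_expl.
Qed.

(* The functional equation of [E x = \prod_(j >= 1) (1 - x / q^j)], up to the  *)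
(* error made by truncating its power series.                                  *)
Lemma euler_shift (x : R) M :
  euler (q * x) M = (1 - x) * euler x M + (-1) ^+ M * (x ^+ M.+1 / qfact q M).
Proof.
elim: M => [|M IH].
  by rewrite /bonferroni !big_ord1 /qfact big_ord0 !expr0 expr1; field.
rewrite !bonferroniS IH qfactS.
have c0 := qfact_gt0 q_gt1 M.
have d0 : 0 < q ^+ M.+1 - 1 by rewrite subr_gt0 exprn_egt1.
rewrite exprMn [x ^+ M.+2]exprS [(-1) ^+ M.+1]exprS.
set s := q ^+ M.+1 in d0 *.
by field; rewrite !gt_eqF.
Qed.

Definition euler_partial u n : R := \prod_(1 <= k < n.+1) (1 - q ^- (k + u)).

Lemma euler_factor_itv u k : (0 < k)%N -> 0 <= 1 - q ^- (k + u) <= 1.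
Proof.
move=> k0; rewrite subr_ge0 gerBl invr_ge0 exprn_ge0 ?(ltW q_gt0) // andbT.
by rewrite invf_le1 ?exprn_gt0 // exprn_ege1 // ltW.
Qed.

Lemma euler_partial_ge0 u n : 0 <= euler_partial u n.
Proof.
rewrite /euler_partial big_nat_cond; apply: prodr_ge0 => k /andP[/andP[k0 _] _].
by have /andP[] := euler_factor_itv u k0.
Qed.

Lemma euler_partialS u n : euler_partial u n.+1 = euler_partial u n * (1 - q ^- (n.+1 + u)).
Proof. by rewrite /euler_partial big_nat_recr. Qed.

Lemma euler_partial_le1 u n : euler_partial u n <= 1.
Proof.
elim: n => [|n IH]; first by rewrite /euler_partial big_geq.
have /andP[f0 f1] := euler_factor_itv u (ltn0Sn n).
by rewrite euler_partialS mulr_ile1 ?euler_partial_ge0.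
Qed.

Lemma is_cvg_euler_partial u : cvgn (euler_partial u).
Proof.
apply: nonincreasing_is_cvgn.
  apply/nonincreasing_seqP => n; have /andP[_ f1] := euler_factor_itv u (ltn0Sn n).
  by rewrite euler_partialS ler_piMr ?euler_partial_ge0.
by exists 0 => _ [n _ <-]; exact: euler_partial_ge0.
Qed.

(** Iterate [euler_shift]: the [j]-th step costs at most q^-j divided by [qfact q M], and these
    powers sum to at most 1 - q^-n because q >= 2. *)
Lemma euler_partial_bound u M n :
  `|euler (q ^- u) M - euler_partial u n * euler (q ^- (n + u)) M|
    <= (1 - q ^- n) / qfact q M.
Proof.
have c0 := qfact_gt0 q_gt1 M.
have qi0 m : 0 <= q ^- m by rewrite invr_ge0 exprn_ge0 // ltW.
have qi1 m : q ^- m <= 1 by rewrite invf_le1 ?exprn_gt0 // exprn_ege1 // ltW.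
elim: n => [|n IH].
  by rewrite /euler_partial big_geq // mul1r subrr normr0 expr0 invr1 subrr mul0r.
set x := q ^- (n.+1 + u).
have qx : q ^- (n + u) = q * x.
  by rewrite /x addSn exprS invfM mulrA divff ?mul1r // gt_eqF.
have -> : euler (q ^- u) M - euler_partial u n.+1 * euler x M =
   (euler (q ^- u) M - euler_partial u n * euler (q ^- (n + u)) M)
   + euler_partial u n * ((-1) ^+ M * (x ^+ M.+1 / qfact q M)).
  by rewrite qx euler_shift euler_partialS -/x; ring.
apply: le_trans (ler_normD _ _) _.
apply: (@le_trans _ _ ((1 - q ^- n) / qfact q M + q ^- n.+1 / qfact q M)).
  apply: lerD => //; rewrite normrM normrM normr_sign mul1r normrM
    normfV (ger0_norm (ltW c0)) mulrA.
  apply: ler_wpM2r; first by rewrite invr_ge0 ltW.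
  rewrite !ger0_norm ?euler_partial_ge0 ?exprn_ge0 ?qi0 // -[leRHS]mul1r.
  apply: ler_pM; rewrite ?euler_partial_ge0 ?exprn_ge0 ?qi0 //.
    exact: euler_partial_le1.
  apply: (@le_trans _ _ x); first by rewrite exprS ler_piMr ?exprn_ile1 ?qi0 ?qi1.
  by rewrite lef_pV2 ?posrE ?exprn_gt0 // ler_weXn2l ?(ltW q_gt1) // leq_addr.
rewrite -mulrDl ler_pM2r ?invr_gt0 //.
have qn : q ^- n = q * q ^- n.+1 by rewrite exprS invfM mulrA divff ?mul1r // gt_eqF.
have : 2 * q ^- n.+1 <= q ^- n by rewrite qn ler_wpM2r ?qi0 // ler_nat.
by lra.
Qed.

(** Let [n] tend to infinity in [euler_partial_bound]: the argument q^-(n+u) tends to 0, where the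
    truncated series equals 1. *)
Lemma euler_limit_bound u M :
  `|euler (q ^- u) M - limn (euler_partial u)| <= (qfact q M)^-1.
Proof.
have c0 := qfact_gt0 q_gt1 M.
have xc : ((fun n => q ^- (n + u)) @ \oo --> (0 : R))%classic.
  rewrite (_ : (fun n => _) = (fun n => q ^- u * q^-1 ^+ n)); last first.
    by apply/funext => n; rewrite exprD invfM mulrC exprVn.
  rewrite -[X in (_ --> X)%classic](mulr0 (q ^- u)); apply: cvgM; first exact: cvg_cst.
  by apply: cvg_expr; rewrite ger0_norm ?invr_ge0 ?(ltW q_gt0) // invf_lt1.
have ec : ((fun n => euler (q ^- (n + u)) M) @ \oo --> (1 : R))%classic.
  have e0 : euler 0 M = 1 :> R.
    rewrite /bonferroni big_ord_recl big1 => [|i _].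
      by rewrite /qfact big_ord0 !expr0 divr1 mulr1 addr0.
    by rewrite lift0 expr0n mul0r mulr0.
  rewrite -[X in (_ --> X)%classic]e0.
  apply: (@cvg_bonferroni R q (fun n => GRing.exp (q ^- (n + u))) (GRing.exp 0) M) => k.
  have kc : {for (0 : R), continuous (fun x : R => x ^+ k)} by exact: exprn_continuous.
  have := continuous_cvg _ kc xc; exact.
have pc : cvgn (euler_partial u) by exact: is_cvg_euler_partial.
have dc : ((fun n => `|euler (q ^- u) M - euler_partial u n * euler (q ^- (n + u)) M|) @ \oo
    --> `|euler (q ^- u) M - limn (euler_partial u) * 1|)%classic.
  apply: cvg_norm; apply: cvgB; first exact: cvg_cst.
  by apply: cvgM.
rewrite -[X in _ - X]mulr1; apply: ler_cvg_to dc (cvg_cst _) _.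
apply: nearW => n; apply: le_trans (euler_partial_bound _ _ _) _.
by rewrite -[leRHS]mul1r ler_pM2r ?invr_gt0 // gerBl invr_ge0 exprn_ge0 // ltW.
Qed.


End EulerProduct.

(** * Counting presentations modulo a power of p *)

Section ResidueCounts.
Variables (R : realType) (p N : nat).
Hypothesis p_prime : prime p.
Variables (B : finZmodType) (n m : nat).
Hypothesis B_exp : forall x : B, x *+ (p ^ N) = 0.
Local Notation Q := 'Z_(p ^ N.+1).
Variables (A A' : {ffun 'I_n -> B} -> 'M[int]_n).
Hypothesis AP : forall b : {ffun 'I_n -> B}, relation_basis p N b (A b) (A' b).
Implicit Types (b : {ffun 'I_n -> B}) (M : 'M[Q]_(n, m)).

Definition annihilates b M := [forall j, mod_comb b M j == 0].

Definition dual_trivial b M :=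
  [forall W : 'M['F_p]_(1, n), (dual_mx N (A' b) W *m M == 0) ==> (W == 0)].

Definition gen_tuples : {set {ffun 'I_n -> B}} :=
  [set b | tuple_span (b : {ffun 'I_n -> B}) == [set: B]%G]%SET.

Definition presentation_count M : R :=
  \sum_(b in gen_tuples) (annihilates b M && dual_trivial b M)%:R.

Definition dual_count b M k : nat :=
  #|[set W : 'M['F_p]_(k, n) | row_free W & dual_mx N (A' b) W *m M == 0]%SET|.

Definition dual_moment M k : R :=
  \sum_(b in gen_tuples) (annihilates b M)%:R * (dual_count b M k)%:R.

Lemma presentation_count_res (X : 'M[padic_int p]_(n, m)) :
  presentation_count (res_mx N X) =
  (#|Aut [set: B]%G| * `[< additively_isomorphic (cok X) B >])%N%:R.
Proof.
have -> : (#|Aut [set: B]%G| * `[< additively_isomorphic (cok X) B >])%N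
    = #|[set b : {ffun 'I_n -> B} | `[< presents N X b >]]%SET|.
  by rewrite (card_presents p_prime B_exp X); case: asboolP; rewrite ?muln1 ?muln0.
rewrite /presentation_count -natr_sum -sum1_card [in LHS]big_mkcond [in RHS]big_mkcond.
congr (_%:R); apply: eq_bigr => b _; rewrite !inE.
have kerE := padic_kernel_eq_image p_prime B_exp (AP b) X.
have dtP : dual_trivial b (res_mx N X) <->
    (forall W : 'M['F_p]_(1, n), dual_mx N (A' b) W *m res_mx N X = 0 -> W = 0).
  split=> [/forallP dt W W0|dt].
    by apply/eqP; have := dt W; rewrite W0 eqxx.
  by apply/forallP => W; apply/implyP => /eqP/dt/eqP.
have annP : annihilates b (res_mx N X) <-> (forall j, mod_comb b (res_mx N X) j = 0).
  by split=> [/forallP an j|an]; [apply/eqP|apply/forallP => j; apply/eqP].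
case: asboolP => [[/eqP -> ker]|npres].
  have /kerE[/annP -> /dtP ->] := ker; by [].
case: ifP => // /eqP gen; case: (boolP (_ && _)) => // /andP[/annP an /dtP dt].
by case: npres; split=> //; apply/kerE.
Qed.

(** Factor [M] through the relation lattice as A Y. The forms killing [M] are the left kernel of [Y]
    modulo [p], so the counts are [inj_count] at its dimension. *)
Lemma dual_count_bonferroni b M L : annihilates b M ->
  `|(dual_trivial b M)%:R - bonferroni p%:R (fun k => (dual_count b M k)%:R) L|
    <= (dual_count b M L.+1)%:R / qfact (p%:R : R) L.+1.
Proof.
move=> /forallP an.
have [Y MY] := relation_factor (AP b) (fun j => eqP (an j)).
pose r := \rank (kermx (intr_mx ('F_p) Y)).
have countE k : (dual_count b M k)%:R = inj_count (p%:R : R) r k.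
  rewrite -[p in RHS](card_Fp p_prime) -card_row_free; congr (_%:R).
  apply: eq_card => W; rewrite !inE.
  by rewrite (dual_mx_mul_eq0 p_prime _ (AP b) MY).
have trivE : dual_trivial b M = (r == 0%N).
  rewrite mxrank_eq0 kermx_eq0.
  apply/forallP/idP => [dt|fr W]; last first.
    rewrite (dual_mx_mul_eq0 p_prime _ (AP b) MY); apply/implyP => /eqP WY.
    by apply/eqP; apply: (row_free_inj fr); rewrite WY mul0mx.
  apply: inj_row_free => W WY; apply/eqP; have := dt W.
  by rewrite (dual_mx_mul_eq0 p_prime _ (AP b) MY) WY eqxx.
rewrite countE trivE.
have -> : bonferroni (p%:R : R) (fun k => (dual_count b M k)%:R) L
    = bonferroni p%:R (inj_count p%:R r) L.
  by apply: eq_bigr => k _; rewrite countE.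
by apply: bonferroni_bound; rewrite ltr1n prime_gt1.
Qed.

Lemma presentation_count_bonferroni M L :
  `|presentation_count M - bonferroni p%:R (dual_moment M) L|
    <= dual_moment M L.+1 / qfact (p%:R : R) L.+1.
Proof.
have -> : bonferroni (p%:R : R) (dual_moment M) L = \sum_(b in gen_tuples)
    (annihilates b M)%:R * bonferroni p%:R (fun k => (dual_count b M k)%:R) L.
  under [RHS]eq_bigr do rewrite mulr_sumr.
  rewrite exchange_big; apply: eq_bigr => k _ /=.
  by rewrite mulr_suml mulr_sumr; apply: eq_bigr => b _; rewrite -mulrA mulrCA.
rewrite -sumrB mulr_suml; apply: le_trans (ler_norm_sum _ _ _) _.
apply: ler_sum => b _; case: (boolP (annihilates b M)) => [an|_].
  by rewrite !mul1r; exact: dual_count_bonferroni.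
by rewrite /= !mul0r subrr normr0.
Qed.

End ResidueCounts.

(** * Expected counts for independent entries *)

Section EntrywiseMean.
Variables (R : realType) (p N : nat) (n m : nat).
Local Notation Q := 'Z_(p ^ N.+1).
Variable q : 'I_m -> 'I_n -> Q -> R.
Hypothesis q_ge0 : forall j i t, 0 <= q j i t.

Definition mx_of_cols (a : {ffun 'I_m -> {ffun 'I_n -> Q}}) : 'M[Q]_(n, m) :=
  \matrix_(i, j) a j i.

Definition weight (a : {ffun 'I_m -> {ffun 'I_n -> Q}}) : R :=
  \prod_j \prod_i q j i (a j i).

Definition mean (f : 'M[Q]_(n, m) -> R) : R := \sum_a weight a * f (mx_of_cols a).

Lemma weight_ge0 a : 0 <= weight a.
Proof. by apply: prodr_ge0 => j _; exact: prodr_ge0. Qed.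

Lemma mean_sum (I : Type) (r : seq I) (P : pred I) (f : I -> 'M[Q]_(n, m) -> R) :
  mean (fun M => \sum_(i <- r | P i) f i M) = \sum_(i <- r | P i) mean (f i).
Proof.
rewrite /mean exchange_big; apply: eq_bigr => a _ /=.
by rewrite mulr_sumr.
Qed.

Lemma meanZ c f : mean (fun M => c * f M) = c * mean f.
Proof. by rewrite /mean mulr_sumr; apply: eq_bigr => a _; rewrite mulrCA. Qed.

Lemma meanB f g : mean (fun M => f M - g M) = mean f - mean g.
Proof. by rewrite /mean -sumrB; apply: eq_bigr => a _; rewrite mulrBr. Qed.

Lemma ler_norm_mean f g : (forall M, `|f M| <= g M) -> `|mean f| <= mean g.
Proof.
move=> fg; apply: le_trans (ler_norm_sum _ _ _) _; apply: ler_sum => a _.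
by rewrite normrM ger0_norm ?weight_ge0 // ler_wpM2l ?weight_ge0.
Qed.

Lemma mean_annihilates (G : finZmodType) (c : 'I_n -> G) :
  mean (fun M => [forall j, \sum_i c i *+ M i j == 0]%:R) =
  tuple_prob (fun t : Q => t : nat) q c.
Proof.
rewrite /tuple_prob; under eq_bigr do rewrite comb_lawE big_mkcond /=.
rewrite bigA_distr_bigA /=; apply: eq_bigr => a _.
have colE j : \sum_i c i *+ mx_of_cols a i j = \sum_i c i *+ a j i.
  by apply: eq_bigr => i _; rewrite mxE.
case: forallP => [ca|nca].
  by rewrite mulr1; apply: eq_bigr => j _; rewrite -colE ca.
have [j cj] : exists j, ~~ (\sum_i c i *+ mx_of_cols a i j == 0).
  by apply/existsP; rewrite -negb_forall; apply/negP => /forallP.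
by rewrite mulr0 (bigD1 j) //= -colE (negPf cj) mul0r.
Qed.

Variables (B : finZmodType) (A' : {ffun 'I_n -> B} -> 'M[int]_n).

Lemma mean_dual_moment k :
  mean (fun M => dual_moment R A' M k) =
  \sum_(b in gen_tuples B n) \sum_(W : 'M['F_p]_(k, n) | row_free W)
     tuple_prob (fun t : Q => t : nat) q (ext_tuple N b (A' b) W).
Proof.
rewrite /dual_moment mean_sum; apply: eq_bigr => b _.
under [RHS]eq_bigr do rewrite -mean_annihilates.
rewrite -mean_sum; congr mean; apply/funext => M.
rewrite -[dual_count _ _ _ _]sum1_card natr_sum mulr_sumr big_mkcond [RHS]big_mkcond.
apply: eq_bigr => W _; rewrite inE; case: (row_free W) => //=.
have -> : [forall j, \sum_i ext_tuple N b (A' b) W i *+ M i j == 0] =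
   annihilates b M && (dual_mx N (A' b) W *m M == 0).
  apply/forallP/andP => [e|[/forallP e1 /eqP e2] j]; last first.
    rewrite ext_comb (eqP (e1 j)) e2; apply/eqP; congr (_, _).
    by apply/colP => i; rewrite !mxE.
  split; first by apply/forallP => j; have := e j; rewrite ext_comb -pair_eqE => /andP[].
  apply/eqP/matrixP => i j; have := e j; rewrite ext_comb -pair_eqE => /andP[_ /eqP].
  by move/(congr1 (fun V : 'cV_k => V i 0)); rewrite /= mxE => ->; rewrite !mxE.
by case: (annihilates b M); case: eqP => _; rewrite ?mulr1 ?mul0r.
Qed.

Hypothesis p_prime : prime p.
Variable A : {ffun 'I_n -> B} -> 'M[int]_n.
Hypothesis AP : forall b : {ffun 'I_n -> B}, relation_basis p N b (A b) (A' b).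

(** [ext_tuple] is injective, so the sum over the pairs (b, W) is part of the sum over all tuples;
    on these pairs the span always has order |B| p^k, whence the explicit main term. *)
Lemma mean_dual_moment_dist k :
  `|mean (fun M => dual_moment R A' M k) -
    #|gen_tuples B n|%:R * inj_count p%:R n k * (#|B| * p ^ k)%:R^-1 ^+ m| <=
  \sum_(c : {ffun 'I_n -> B * 'cV[Q]_k})
     `|tuple_prob (fun t : Q => t : nat) q c - #|tuple_span c|%:R^-1 ^+ m|.
Proof.
pose S := [set bW : {ffun 'I_n -> B} * 'M['F_p]_(k, n) |
   (bW.1 \in gen_tuples B n) && row_free bW.2]%SET.
pose h (bW : {ffun 'I_n -> B} * 'M['F_p]_(k, n)) := ext_tuple N bW.1 (A' bW.1) bW.2.
have h_inj : injective h.
  move=> [b1 W1] [b2 W2] e; have [|/= /ffunP -> -> //] := ext_tuple_inj p_prime (AP b1) _ e.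
  by move/ffunP => ->.
have -> : #|gen_tuples B n|%:R * inj_count p%:R n k * (#|B| * p ^ k)%:R^-1 ^+ m =
   \sum_(bW in S) #|tuple_span (h bW)|%:R^-1 ^+ m :> R.
  (* A matrix with no columns imposes no condition, and its left kernel has dimension [n]. *)
  have -> : inj_count p%:R n k = #|[set W : 'M['F_p]_(k, n) | row_free W]%SET|%:R :> R.
    have := card_row_free (0 : 'M['F_p]_(n, 0)) R k.
    rewrite card_Fp // (_ : \rank (kermx _) = n) => [<-|]; last first.
      by rewrite mxrank_ker mxrank0 subn0.
    by congr (_%:R); apply: eq_card => W; rewrite !inE mulmx0 eqxx andbT.
  rewrite (eq_bigr (fun=> (#|B| * p ^ k)%:R^-1 ^+ m)); last first.
    move=> [b W]; rewrite !inE /= => /andP[/eqP bT fW].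
    by rewrite (card_span_ext_tuple p_prime (AP b)).
  rewrite sumr_const -natrM -[RHS]mulr_natl; congr (_%:R * _).
  by rewrite -cardsX; apply: eq_card => bW; rewrite !inE.
rewrite mean_dual_moment pair_big_dep /=.
rewrite (eq_bigl (fun bW => bW \in S)) => [|bW]; last by rewrite !inE.
rewrite -sumrB; apply: le_trans (ler_norm_sum _ _ _) _.
rewrite -(big_imset (fun c : {ffun 'I_n -> B * 'cV[Q]_k} =>
   `|tuple_prob (fun t : Q => t : nat) q c - #|tuple_span c|%:R^-1 ^+ m|)) /=; last first.
  by move=> x y _ _; exact: h_inj.
by rewrite big_mkcond; apply: ler_sum => c _; case: ifP.
Qed.

End EntrywiseMean.

(** * Limits of the main terms *)

Section MainTermLimits.
Variable R : realType.

(** Union bound: a tuple that does not generate lies in a proper subgroup, of order at most |B|/2,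
    and the number of subgroups is fixed. *)
Lemma cvg_gen_tuples (B : finZmodType) :
  ((fun n => #|gen_tuples B n|%:R / #|B|%:R ^+ n) @ \oo --> (1 : R))%classic.
Proof.
have B0 : (0 < #|B|%:R :> R)%R by rewrite ltr0n; apply/card_gt0P; exists 0.
pose s : R := #|{: {group B}}|%:R.
have lc : ((fun n => 1 - s * (2^-1) ^+ n) @ \oo --> (1 : R))%classic.
  rewrite -[X in (_ --> X)%classic]subr0 -[X in _ - X](mulr0 s).
  apply: cvgB; first exact: cvg_cst.
  apply: cvgM; first exact: cvg_cst.
  by apply: cvg_expr; rewrite ger0_norm; lra.
apply: (@squeeze_cvgr _ _ _ _ _ (fun=> 1) _ _ _ lc); last exact: cvg_cst.
apply: nearW => n; have Bn0 := exprn_gt0 n B0.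
have cardE : #|B|%:R ^+ n = \sum_(b : {ffun 'I_n -> B}) 1 :> R.
  by rewrite sumr_const -natrX cardT -cardE card_ffun card_ord.
apply/andP; split; last first.
  rewrite ler_pdivrMr // mul1r cardE -sum1_card natr_sum big_mkcond.
  by apply: ler_sum => b _; case: ifP.
rewrite ler_pdivlMr // mulrBl mul1r lerBlDr -lerBlDl.
have -> : #|B|%:R ^+ n - #|gen_tuples B n|%:R =
    \sum_(b : {ffun 'I_n -> B}) (1 - (if b \in gen_tuples B n then 1 else 0)) :> R.
  by rewrite sumrB -cardE -big_mkcond sumr_const.
apply: (@le_trans _ _ (\sum_(b : {ffun 'I_n -> B}) \sum_(H : {group B} | H != [set: B]%G)
    \prod_i ((i \in finset.set0) || (b i \in H))%:R)).
  apply: ler_sum => b _; case: ifP => bT.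
    by rewrite subrr sumr_ge0 // => H _; rewrite prodr_ge0.
  rewrite subr0 (bigD1 (tuple_span b)) /=; last by move: bT; rewrite inE => ->.
  rewrite big1 => [|i _]; last by rewrite gen_mem ?orbT // inE.
  by rewrite lerDl sumr_ge0 // => H _; rewrite prodr_ge0.
rewrite exchange_big /=.
under eq_bigr do rewrite sum_ffun_restricted cards0 expr0 mul1r setC0 cardsT card_ord.
apply: (@le_trans _ _ (\sum_(H : {group B}) (2^-1 * #|B|%:R) ^+ n)); last first.
  by rewrite sumr_const -[leLHS]mulr_natl exprMn mulrA.
rewrite big_mkcond; apply: ler_sum => H _; case: ifP => HT; last first.
  by rewrite exprn_ge0 // mulr_ge0 // ltW.
rewrite lerXn2r ?nnegrE ?mulr_ge0 ?invr_ge0 // mulrC ler_pdivlMr // -natrM ler_nat.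
have := Lagrange (subsetT H); rewrite cardsT => <-.
rewrite leq_mul2l; apply/orP; right.
rewrite ltn_neqAle indexg_gt0 andbT eq_sym indexg_eq1.
apply: contra HT => sub; apply/eqP/val_inj/eqP.
by rewrite eqEsubset subsetT /=.
Qed.

Lemma cvg_inj_count (q : R) k : 1 < q ->
  ((fun n => inj_count q n k * (q ^+ n)^-1 ^+ k) @ \oo --> (1 : R))%classic.
Proof.
move=> q1; have q0 := lt_trans ltr01 q1.
have f1 i : ((fun n => 1 - q ^+ i * q^-1 ^+ n) @ \oo --> (1 : R))%classic.
  rewrite -[X in (_ --> X)%classic]subr0 -[X in _ - X](mulr0 (q ^+ i)).
  apply: cvgB; first exact: cvg_cst.
  apply: cvgM; first exact: cvg_cst.
  by apply: cvg_expr; rewrite ger0_norm ?invr_ge0 ?ltW // invf_lt1.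
elim: k => [|k IH].
  by under eq_fun do rewrite /inj_count big_ord0 expr0 mulr1; exact: cvg_cst.
rewrite (_ : (fun n => _) = (fun n => (inj_count q n k * (q ^+ n)^-1 ^+ k) *
   (1 - q ^+ k * q^-1 ^+ n))).
  by rewrite -[X in (_ --> X)%classic]mulr1; apply: cvgM.
apply/funext => n; rewrite /inj_count big_ord_recr /= exprSr mulrACA; congr (_ * _).
by rewrite mulrBl divff ?exprVn // gt_eqF // exprn_gt0.
Qed.

Lemma cvg_main_term (B : finZmodType) p u k : (1 < p)%N ->
  ((fun n => #|gen_tuples B n|%:R * inj_count p%:R n k * (#|B| * p ^ k)%:R^-1 ^+ (n + u))
    @ \oo --> (#|B|%:R^-1 ^+ u * (p%:R ^- u) ^+ k : R))%classic.
Proof.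
move=> p1; have B0 : (0 < #|B|%:R :> R)%R by rewrite ltr0n; apply/card_gt0P; exists 0.
have q0 : 0 < p%:R :> R by rewrite ltr0n ltnW.
have E n : #|gen_tuples B n|%:R * inj_count p%:R n k * (#|B| * p ^ k)%:R^-1 ^+ (n + u) =
   (#|gen_tuples B n|%:R / #|B|%:R ^+ n) * (inj_count p%:R n k * (p%:R ^+ n)^-1 ^+ k)
   * (#|B|%:R^-1 ^+ u * (p%:R ^- u) ^+ k) :> R.
  rewrite natrM natrX invfM exprMn !exprD !exprVn -!exprM [(k * n)%N]mulnC [(k * u)%N]mulnC.
  ring.
have q1 : 1 < p%:R :> R by rewrite ltr1n.
have := cvgM (cvgM (cvg_gen_tuples B) (cvg_inj_count k q1))
  (cvg_cst (#|B|%:R^-1 ^+ u * (p%:R ^- u) ^+ k : R)).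
by rewrite !mul1r => c; rewrite (funext E); exact: c.
Qed.

End MainTermLimits.

(** * Uniform convergence of the expected number of presentations *)

Section Universality.
Variables (R : realType) (p N u : nat) (eps : R) (B : finZmodType).
Hypothesis p_prime : prime p.
Hypothesis eps_gt0 : 0 < eps.
Hypothesis eps_le : eps <= 2^-1.
Hypothesis B_pgroup : (p.-group [set: B]%G)%g.
Local Notation Q := 'Z_(p ^ N.+1).
Local Notation balanced_entries := (balanced p (fun t : Q => t : nat) eps).

Lemma pgroup_ext k : (p.-group [set: (B * 'cV[Q]_k)%type]%G)%g.
Proof.
move: B_pgroup; rewrite /pgroup !cardsT card_prod card_mx pnatM => -> /=.
by rewrite muln1 card_ord Zp_cast ?expn_gt1 // -expnM pnatX pnat_id.
Qed.

Lemma dual_moment_limit : exists2 err : nat -> nat -> R,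
  (forall k, (err k @ \oo --> (0 : R))%classic) &
  forall k n (q : 'I_(n + u) -> 'I_n -> Q -> R) (A A' : {ffun 'I_n -> B} -> 'M[int]_n),
    balanced_entries q ->
    (forall b : {ffun 'I_n -> B}, relation_basis p N b (A b) (A' b)) ->
    `|mean q (fun M => dual_moment R A' M k) -
      #|B|%:R^-1 ^+ u * (p%:R ^- u) ^+ k| <= err k n.
Proof.
suff /choice[err errP] k : exists err : nat -> R, (err @ \oo --> (0 : R))%classic /\
  forall n (q : 'I_(n + u) -> 'I_n -> Q -> R) (A A' : {ffun 'I_n -> B} -> 'M[int]_n),
    balanced_entries q ->
    (forall b : {ffun 'I_n -> B}, relation_basis p N b (A b) (A' b)) ->
    `|mean q (fun M => dual_moment R A' M k) -
      #|B|%:R^-1 ^+ u * (p%:R ^- u) ^+ k| <= err n.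
  by exists err => k; have [] := errP k.
have Q0 : (0 < #|Q|)%N by rewrite card_ord.
have [e e0 eP] := tuple_sum_vanishes (fun t : Q => t : nat) u p_prime
  (pgroup_ext k) eps_gt0 eps_le Q0.
pose main n : R :=
  #|gen_tuples B n|%:R * inj_count p%:R n k * (#|B| * p ^ k)%:R^-1 ^+ (n + u).
pose l : R := #|B|%:R^-1 ^+ u * (p%:R ^- u) ^+ k.
have mainl : (main @ \oo --> l)%classic by apply: cvg_main_term; exact: prime_gt1.
exists (fun n => e n + `|main n - l|); split.
  rewrite -[X in (_ --> X)%classic]addr0; apply: cvgD => //.
  have -> : 0 = `|l - l| :> R by rewrite subrr normr0.
  by apply: cvg_norm; apply: cvgB => //; exact: cvg_cst.
move=> n q A A' qb AP; have [q0 _ _] := qb.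
have -> : mean q (fun M => dual_moment R A' M k) - l =
    (mean q (fun M => dual_moment R A' M k) - main n) + (main n - l) by ring.
apply: le_trans (ler_normD _ _) _; apply: lerD => //.
exact: le_trans (mean_dual_moment_dist _ p_prime AP k) (eP n q qb).
Qed.

(** Three errors are controlled: the truncation at [K], the replacement of the moments by their
    limits, and the tail of Euler's series. The order [K] is fixed first, then [n] grows. *)
Lemma presentation_count_limit (eta : R) : 0 < eta ->
  exists n0, forall n (q : 'I_(n + u) -> 'I_n -> Q -> R)
      (A A' : {ffun 'I_n -> B} -> 'M[int]_n), (n0 <= n)%N ->
    balanced_entries q ->
    (forall b : {ffun 'I_n -> B}, relation_basis p N b (A b) (A' b)) ->
    `|mean q (presentation_count R A') -
      #|B|%:R^-1 ^+ u * limn (euler_partial R p u)| <= eta.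
Proof.
move=> eta0; have p1 := prime_gt1 p_prime.
have [err err0 errP] := dual_moment_limit.
have q1 : 1 < p%:R :> R by rewrite ltr1n.
(* [K] exceeds [4 / eta], and [qfact] grows at least linearly, so the reciprocals from [K] on are at
   most [eta / 4]. *)
pose L := Num.truncn (4 / eta).
pose K := L.+1.
have c1 k : 1 <= qfact (p%:R : R) k by exact: qfact_ge1.
have c0 k : 0 < qfact (p%:R : R) k by exact: lt_le_trans ltr01 (c1 k).
have cK k : (K <= k)%N -> (qfact (p%:R : R) k)^-1 <= eta / 4.
  move=> Kk; rewrite -[eta / 4]invrK invf_div lef_pV2 ?posrE ?divr_gt0 //.
  apply: le_trans (qfact_ge _ p1 _); apply: (@le_trans _ _ K%:R); last by rewrite ler_nat.
  by apply: ltW; exact: truncnS_gt.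
have B1 : 1 <= #|B|%:R :> R by rewrite ler1n; apply/card_gt0P; exists 0.
pose g : R := #|B|%:R^-1 ^+ u.
have g0 : 0 <= g by rewrite exprn_ge0 // invr_ge0 (le_trans ler01).
have g1 : g <= 1.
  by rewrite exprn_ile1 ?invr_ge0 ?invf_le1 ?(le_trans ler01) ?(lt_le_trans ltr01).
have pu0 : 0 <= p%:R ^- u :> R by rewrite invr_ge0 exprn_ge0.
have pu1 : p%:R ^- u <= 1 :> R.
  by rewrite invf_le1 ?exprn_gt0 ?exprn_ege1 ?(ltW q1) // (lt_trans ltr01).
pose t k : R := g * (p%:R ^- u) ^+ k.
have t1 k : t k <= 1 by apply: mulr_ile1 => //; exact: exprn_ile1.
(* The sum includes the moment of order [K.+1], which bounds the truncation error. *)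
have Sc : ((fun n => \sum_(k < K.+2) err k n) @ \oo --> (0 : R))%classic.
  elim: K.+2 => [|k IH].
    by under eq_fun do rewrite big_ord0; exact: cvg_cst.
  rewrite -[X in (_ --> X)%classic](addr0 0); under eq_fun do rewrite big_ord_recr /=.
  exact: cvgD IH (err0 k).
have eta4 : 0 < eta / 4 by rewrite divr_gt0.
have /cvgrPdist_le /(_ _ eta4) [n0 _ Sn] := Sc.
exists n0 => n q A A' n0n qb AP; have [q0 _ _] := qb.
pose D k := mean q (fun M => dual_moment R A' M k).
have hD k : `|D k - t k| <= err k n by exact: errP qb AP.
have {Sn} Sn : \sum_(k < K.+2) err k n <= eta / 4.
  by have := Sn n n0n; rewrite /= sub0r normrN; apply: le_trans; exact: ler_norm.
have meanE : mean q (fun M => bonferroni p%:R (dual_moment R A' M) K) = bonferroni p%:R D K.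
  rewrite /bonferroni mean_sum; apply: eq_bigr => k _.
  rewrite meanZ; congr (_ * _); rewrite /D mulrC -meanZ; congr mean.
  by apply/funext => M; rewrite mulrC.
have E1 : `|mean q (presentation_count R A') - bonferroni p%:R D K| <= eta / 4 + err K.+1 n.
  rewrite -meanE -meanB.
  apply: (@le_trans _ _ (D K.+1 / qfact p%:R K.+1)).
    apply: le_trans (ler_norm_mean q0 (fun M =>
      presentation_count_bonferroni R p_prime AP M K)) _.
    by rewrite /D mulrC -meanZ le_eqVlt; apply/orP; left; apply/eqP; congr mean;
      apply/funext => M; rewrite mulrC.
  have DK : D K.+1 <= 1 + err K.+1 n.
    have := hD K.+1; rewrite ler_distl => /andP[_ h].
    by apply: le_trans h _; rewrite lerD2r.
  have e0 : 0 <= err K.+1 n by exact: le_trans (normr_ge0 _) (hD K.+1).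
  apply: (@le_trans _ _ ((1 + err K.+1 n) / qfact p%:R K.+1)).
    by rewrite ler_wpM2r // invr_ge0 ltW.
  rewrite mulrDl mul1r; apply: lerD; first by rewrite cK.
  by rewrite ler_piMr // invf_le1.
have E2 : `|bonferroni p%:R D K - bonferroni p%:R t K| <= \sum_(k < K.+1) err k n.
  rewrite /bonferroni -sumrB; apply: le_trans (ler_norm_sum _ _ _) _.
  apply: ler_sum => k _; rewrite -mulrBr -mulrBl normrM normr_sign mul1r normrM.
  rewrite normfV (ger0_norm (ltW (c0 k))) ler_pdivrMr //.
  apply: le_trans (hD k) _; apply: ler_peMr => //.
  exact: le_trans (normr_ge0 _) (hD k).
have E3 : `|bonferroni p%:R t K - g * limn (euler_partial R p u)| <= eta / 4.
  have -> : bonferroni p%:R t K = g * bonferroni p%:R (GRing.exp (p%:R ^- u)) K.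
    rewrite /bonferroni mulr_sumr; apply: eq_bigr => k _.
    by rewrite /t -[in LHS]mulrA mulrCA.
  rewrite -mulrBr normrM (ger0_norm g0).
  apply: le_trans (_ : (qfact p%:R K)^-1 <= _); last exact: cK.
  rewrite -[leRHS]mul1r; apply: ler_pM => //.
  exact: euler_limit_bound.
have := Sn; rewrite big_ord_recr /= => {}Sn.
have -> : mean q (presentation_count R A') - g * limn (euler_partial R p u) =
  (mean q (presentation_count R A') - bonferroni p%:R D K) +
  ((bonferroni p%:R D K - bonferroni p%:R t K) +
   (bonferroni p%:R t K - g * limn (euler_partial R p u))) by ring.
apply: le_trans (ler_normD _ _) _.
apply: le_trans (lerD E1 (le_trans (ler_normD _ _) (lerD E2 E3))) _.
by move: Sn eta0; lra.
Qed.

End Universality.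

From mathcomp Require Import classical_sets.
Local Open Scope classical_set_scope.

(** * Random p-adic matrices *)

Section FiniteValued.
Variables (R : realType) (d : measure_display) (Omega : measurableType d).
Variables (P : probability Omega R) (T : finType) (Z : Omega -> T).
Hypothesis mZ : forall t, measurable [set w | Z w = t].

Lemma measure_seq_fibers (s : seq T) : uniq s ->
  measurable [set w | Z w \in s] /\
  P [set w | Z w \in s] = (\sum_(t <- s) P [set w | Z w = t])%E.
Proof.
elim: s => [_|t s IH /= /andP[ts us]].
  by rewrite big_nil (_ : [set w | _] = set0) ?measure0 //; apply/seteqP; split.
have [ms Ps] := IH us.
have -> : [set w | Z w \in t :: s] = [set w | Z w = t] `|` [set w | Z w \in s].
  apply/seteqP; split=> w /=; rewrite inE; first by case/orP => [/eqP|]; [left|right].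
  by case=> [->|->]; rewrite ?eqxx ?orbT.
split; first exact: measurableU.
rewrite big_cons measureU //; first by rewrite -Ps.
by apply/seteqP; split=> // w [/= -> ws]; rewrite ws in ts.
Qed.

Lemma measurable_fibers (E : pred T) : measurable [set w | E (Z w)].
Proof.
have [+ _] := measure_seq_fibers (enum_uniq E); congr measurable.
by apply/seteqP; split=> w /=; rewrite mem_enum.
Qed.

Lemma measure_fibers (E : pred T) :
  P [set w | E (Z w)] = (\sum_(t | E t) P [set w | Z w = t])%E.
Proof.
have [_] := measure_seq_fibers (enum_uniq E).
rewrite big_enum /= => <-; congr (P _).
by apply/seteqP; split=> w /=; rewrite mem_enum.
Qed.

Lemma fine_measure_fibers (E : pred T) :
  fine (P [set w | E (Z w)]) = \sum_(t | E t) fine (P [set w | Z w = t]).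
Proof.
rewrite measure_fibers sum_fine // => t _.
exact: fin_num_measure.
Qed.

End FiniteValued.

Section PadicMeasurable.
Variables (p : nat) (p_prime : prime p).

Lemma measurable_residue k (t : 'Z_(p ^ k.+1)) :
  measurable [set x : padic_int p | residue x k = t].
Proof.
apply: sub_sigma_algebra; rewrite /open /=.
by move=> x /= xt; exists k => y yx; rewrite yx.
Qed.

End PadicMeasurable.

Section RandomMatrix.
Variables (R : realType) (p : nat) (N : nat) (p_prime : prime p) (n m : nat).
Variables (d : measure_display) (Omega : measurableType d) (P : probability Omega R).
Variable X : Omega -> 'M[padic_int p]_(n, m).
Hypothesis X_measurable : forall i j, measurable_fun setT (fun w => X w i j).
Local Notation Q := 'Z_(p ^ N.+1).

Definition residue_law (j : 'I_m) (i : 'I_n) (t : Q) : R :=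
  fine (P [set w | residue (X w i j) N = t]).

Lemma measurable_entry_residue k i j (t : 'Z_(p ^ k.+1)) :
  measurable [set w | residue (X w i j) k = t].
Proof.
have := X_measurable i j measurableT (measurable_residue t).
by rewrite setTI.
Qed.

Lemma residue_law_ge0 j i t : 0 <= residue_law j i t.
Proof. by rewrite fine_ge0. Qed.

Lemma residue_law_sum1 j i : \sum_t residue_law j i t = 1.
Proof.
have := fine_measure_fibers P (fun t => measurable_entry_residue i j t) xpredT.
by move=> <-; rewrite (_ : [set w | _] = setT) ?probability_setT //; apply/seteqP.
Qed.

Lemma residue_law_balanced (eps : R) :
  (forall i j (r : 'Z_p), (P [set w | residue (X w i j) 0 = r] <= (1 - eps)%:E)%E) ->
  forall j i r, \sum_(t : Q | (t : nat) == r %[mod p]) residue_law j i t <= 1 - eps.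
Proof.
move=> bal j i r.
have mE := @measurable_fibers R d Omega P Q _
  (fun t => measurable_entry_residue i j t) (fun t : Q => (t : nat) == r %[mod p])%N.
have := fine_measure_fibers P (fun t => measurable_entry_residue i j t)
  (fun t : Q => (t : nat) == r %[mod p])%N.
move=> <-; rewrite -lee_fin fineK; last exact: fin_num_measure.
apply: le_trans (bal i j (inZp r)); apply: le_measure; rewrite ?inE.
- exact: mE.
- exact: measurable_entry_residue.
move=> w /= /eqP er; apply: val_inj; apply: etrans (residue_mod p_prime _ (leq0n N)) _.
by rewrite [X in (_ %% X)%N]expn1 er -(val_Zp_nat (prime_gt1 p_prime)) Zp_nat.
Qed.

Hypothesis X_independent : mutually_independent P
  (fun (ij : 'I_n * 'I_m) w => X w ij.1 ij.2).

Definition residue_cols w : {ffun 'I_m -> {ffun 'I_n -> Q}} :=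
  [ffun j => [ffun i => residue (X w i j) N]].

Lemma fiber_residue_cols a : [set w | residue_cols w = a] =
  [set w | forall ij : 'I_n * 'I_m, ij \in [set: 'I_n * 'I_m]%SET ->
     [set x | residue x N = a ij.2 ij.1] (X w ij.1 ij.2)].
Proof.
apply/seteqP; split=> w /= => [<- ij _|e]; first by rewrite !ffunE.
by apply/ffunP => j; apply/ffunP => i; rewrite !ffunE; apply: (e (i, j)); rewrite inE.
Qed.

Lemma measurable_residue_cols a : measurable [set w | residue_cols w = a].
Proof.
rewrite fiber_residue_cols.
rewrite (_ : [set w | _] =
  \bigcap_(ij in setT) [set w | residue (X w ij.1 ij.2) N = a ij.2 ij.1]).
  by apply: fin_bigcap_measurable => // ij _; exact: measurable_entry_residue.
by apply/seteqP; split=> w /= e ij _; apply: e; rewrite ?inE.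
Qed.

Lemma prob_residue_cols a :
  fine (P [set w | residue_cols w = a]) = weight residue_law a.
Proof.
rewrite fiber_residue_cols.
have := @X_independent [set: 'I_n * 'I_m]%SET
  (fun ij => [set x | residue x N = a ij.2 ij.1]) (fun ij => measurable_residue _).
move=> ->.
rewrite (eq_bigr (fun ij => (residue_law ij.2 ij.1 (a ij.2 ij.1))%:E)); last first.
  move=> ij _; rewrite fineK // fin_num_measure //; exact: measurable_entry_residue.
rewrite prodEFin /= (eq_bigl xpredT) => [|ij]; last by rewrite inE.
by rewrite -(pair_bigA _ (fun i j => residue_law j i (a j i))) exchange_big.
Qed.

End RandomMatrix.

Section CokernelLaw.
Variables (R : realType) (p : nat) (N : nat) (p_prime : prime p) (n m : nat).
Variables (d : measure_display) (Omega : measurableType d) (P : probability Omega R).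
Variable X : Omega -> 'M[padic_int p]_(n, m).
Hypothesis X_measurable : forall i j, measurable_fun setT (fun w => X w i j).
Hypothesis X_independent : mutually_independent P
  (fun (ij : 'I_n * 'I_m) w => X w ij.1 ij.2).
Variable B : finZmodType.
Hypothesis B_exp : forall x : B, x *+ (p ^ N) = 0.
Variables A A' : {ffun 'I_n -> B} -> 'M[int]_n.
Hypothesis AP : forall b : {ffun 'I_n -> B}, relation_basis p N b (A b) (A' b).

Let presented (a : {ffun 'I_m -> {ffun 'I_n -> 'Z_(p ^ N.+1)}}) :=
  0 < presentation_count R A' (mx_of_cols a).

Let Aut_gt0 : 0 < #|Aut [set: B]%G|%:R :> R.
Proof. by rewrite ltr0n cardG_gt0. Qed.

Let iso_presented : [set w | additively_isomorphic (cok (X w)) B] =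
  [set w | presented (residue_cols N X w)].
Proof.
apply/seteqP; suff iso w : presented (residue_cols N X w) =
    `[< additively_isomorphic (cok (X w)) B >].
  by split=> w /=; rewrite iso => /asboolP.
rewrite /presented (_ : mx_of_cols _ = res_mx N (X w)); last first.
  by apply/matrixP => i j; rewrite !mxE !ffunE.
rewrite (presentation_count_res R p_prime B_exp AP).
by case: asboolP; rewrite ?muln1 ?muln0 ?Aut_gt0 ?ltxx.
Qed.

Lemma measurable_cok_iso : measurable [set w | additively_isomorphic (cok (X w)) B].
Proof.
rewrite iso_presented.
exact: (@measurable_fibers R d Omega P _ _ (measurable_residue_cols X_measurable)).
Qed.

(** Every residue matrix lifts to a p-adic one, so [presentation_count] takes only the values
    [#|Aut B|] and 0, and the event is a union of fibers of the residues. *)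
Lemma prob_cok_iso :
  #|Aut [set: B]%G|%:R * fine (P [set w | additively_isomorphic (cok (X w)) B]) =
  mean (N := N) (residue_law P X) (presentation_count R A').
Proof.
rewrite iso_presented (fine_measure_fibers P (measurable_residue_cols X_measurable)).
rewrite /mean big_mkcond mulr_sumr; apply: eq_bigr => a _.
rewrite (prob_residue_cols X_measurable X_independent) /presented.
have [Y ->] : exists Y : 'M[padic_int p]_(n, m), mx_of_cols a = res_mx N Y.
  exists (\matrix_(i, j) (a j i : nat)%:R); apply/matrixP => i j.
  by rewrite !mxE /res residue_natr natr_Zp.
rewrite (presentation_count_res R p_prime B_exp AP).
by case: asboolP; rewrite ?muln1 ?muln0 ?Aut_gt0 ?ltxx ?mulr0 // mulrC.
Qed.

End CokernelLaw.

Theorem theorem1p3 (R : realType) (p : nat) (p_prime : prime p)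
    (eps : R) (eps_gt0 : 0 < eps) (u : nat)
    (d : nat -> measure_display) (Omega : forall n, measurableType (d n))
    (P : forall n, probability (Omega n) R)
    (X : forall n, Omega n -> 'M[padic_int p]_(n, n + u))
    (X_measurable : forall n i j, measurable_fun setT (fun w => X n w i j))
    (X_independent : forall n, mutually_independent (P n)
       (fun (ij : 'I_n * 'I_(n + u)) w => X n w ij.1 ij.2))
    (X_balanced : forall n i j (r : 'Z_p),
       (P n [set w | residue (X n w i j) 0 = r] <= (1 - eps)%:E)%E)
    (B : finZmodType) (B_pgroup : (p.-group [set: B]%G)%g) :
  (fun n => P n [set w | additively_isomorphic (cok (X n w)) B]) @ \oo -->
    (limn (fun N : nat => \prod_(1 <= k < N.+1) (1 - p%:R ^- (k + u)) : R)
       / (#|B| ^ u * #|Aut [set: B]%G|)%:R)%:E.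
Proof.
(* Decreasing [eps] keeps the entries balanced and provides the bound by one half that the index
   argument for degenerate tuples uses. *)
pose eps' := Order.min eps 2^-1.
have eps'_gt0 : 0 < eps' by rewrite lt_min eps_gt0 invr_gt0 ltr0n.
have eps'_le : eps' <= 2^-1 by rewrite ge_min lexx orbT.
have eps'_le1 : eps' <= eps by rewrite ge_min lexx.
have [N BN] : exists N, #|B| = (p ^ N)%N.
  by have [N] := p_natP B_pgroup; rewrite cardsT => ->; exists N.
have B_exp (x : B) : x *+ (p ^ N) = 0.
  rewrite -BN -cardsT -FinRing.zmodXgE.
  exact: (@expg_cardG _ [set: B]%G x (finset.in_setT x)).
have bases n : exists AA : {ffun 'I_n -> B} -> 'M[int]_n * 'M[int]_n,
    forall b : {ffun 'I_n -> B}, relation_basis p N b (AA b).1 (AA b).2.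
  suff /choice[AA AAP] (b : {ffun 'I_n -> B}) : exists C : 'M[int]_n * 'M[int]_n,
      relation_basis p N b C.1 C.2 by exists AA.
  have pN0 : (0 < p ^ N)%N by rewrite expn_gt0 prime_gt0.
  have [C [C' CP]] := int_relations_basis pN0 (fun i => B_exp (b i)).
  by exists (C, C').
have q_balanced n :
    balanced p (fun t : 'Z_(p ^ N.+1) => t : nat) eps' (residue_law (P n) (@X n)).
  split; [exact: residue_law_ge0|exact: residue_law_sum1|].
  apply: residue_law_balanced => // i j r; apply: le_trans (X_balanced n i j r) _.
  by rewrite lee_fin lerD2l lerN2.
set L := limn _.
have Aut_ge1 : 1 <= #|Aut [set: B]%G|%:R :> R by rewrite ler1n cardG_gt0.
apply: cvg_EFin.
  apply: nearW => n; have [AA AAP] := bases n.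
  apply: fin_num_measure.
  exact: (measurable_cok_iso p_prime (P n) (X_measurable n) B_exp AAP).
apply/cvgrPdist_le => eta eta0.
have [n0 near0] := presentation_count_limit N u p_prime eps'_gt0 eps'_le B_pgroup eta0.
exists n0 => // n n0n /=.
have [AA AAP] := bases n.
have := near0 n _ _ _ n0n (q_balanced n) AAP.
rewrite -(prob_cok_iso p_prime (X_measurable n) (X_independent n) B_exp AAP).
set a := #|Aut _|%:R in Aut_ge1 *; set y := fine _.
have a0 : 0 < a by exact: lt_le_trans Aut_ge1.
rewrite -/L; have -> : a * y - #|B|%:R^-1 ^+ u * L =
    a * (y - L / (#|B| ^ u * #|Aut [set: B]%G|)%:R).
  rewrite natrM natrX -/a mulrBr invfM exprVn; congr (_ - _).
  set c := #|B|%:R ^+ u; have -> : a * (L * (c^-1 * a^-1)) = (a / a) * (c^-1 * L) by ring.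
  by rewrite divff ?mul1r // gt_eqF.
(* The bound concerns [a] times the deviation; as [a >= 1], it bounds the deviation itself. *)
rewrite normrM (ger0_norm (ltW a0)) distrC; apply: le_trans.
by rewrite ler_peMl.
Qed.
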